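(* Let $h \geq 2$ be an integer, and for real $x>2$ let $\mathcal{N}_h(x)$ denote the set of $h$-full natural numbers less than or equal to $x$. Then for every $a\in\mathbb{R}$, $$\lim_{x\to\infty}\frac{1}{|\mathcal{N}_h(x)|}\left|\left\{n\in\mathcal{N}_h(x) \ :\ n\ge 3,\ \frac{\omega_h(n)-\log\log n}{\sqrt{\log\log n}}\leq a\right\}\right| = \Phi(a),$$ where $$\Phi(a) = \frac{1}{\sqrt{2\pi}}\int_{-\infty}^a e^{-u^2/2}\,du.$$
   Context: A natural number $n$ is $h$-full if every prime dividing $n$ has multiplicity at least $h$ in $n$ (so $1$ is $h$-full). $\omega_h(n)$ is the number of distinct primes $p$ with $p^h\,\|\,n$ (i.e. $p^h\mid n$ and $p^{h+1}\nmid n$). *)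

(* Defs.v *)
From mathcomp Require Export all_boot all_order all_algebra finmap.
From mathcomp Require Export all_classical all_reals all_analysis.

Set Implicit Arguments.
Unset Strict Implicit.
Unset Printing Implicit Defensive.

Export Order.TTheory GRing.Theory Num.Theory.
Export numFieldNormedType.Exports.

Local Open Scope classical_set_scope.
Local Open Scope ring_scope.

Definition h_full (h n : nat) : Prop :=
  (0 < n)%N /\ forall p : nat, prime p -> (p %| n)%N -> (h <= logn p n)%N.

Definition omegah (h n : nat) : nat :=
  count (fun p => (p ^ h %| n)%N && ~~ (p ^ h.+1 %| n)%N) (primes n).

Definition Nfull {R : realType} (h : nat) (x : R) : set nat :=
  [set n | h_full h n /\ n%:R <= x].

(* [fset_set] is junk on infinite sets; this shows that it is not used on one
   below. *)
Lemma finite_Nfull (R : realType) (h : nat) (x : R) : finite_set (Nfull h x).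
Proof.
apply: (@sub_finite_set _ _ `I_(Num.truncn x).+1); last exact: finite_II.
move=> n [_ nx] /=; rewrite ltnS truncn_ge_nat //.
exact: le_trans (ler0n _ _) nx.
Qed.

Definition Phi {R : realType} (a : R) : R :=
  (Num.sqrt (2 * pi))^-1 *
  \int[lebesgue_measure]_(u in `]-oo, a]) expR (- u ^+ 2 / 2).

(* Main.v *)
(* Every h-full n is uniquely l^h * twist h b with l >= 1 arbitrary and b h-th
   power free, where twist h b is the product of p^(h + v_p(b)) over the primes
   p | b.  For n <= x and fixed b this lets l range over [1, Y] with Y of order
   x^(1/h), the weights twist(b)^(-1/h) are summable by an Euler product, and
   omega_h(n) differs from the number of prime factors of l by a quantity that
   is bounded in mean.  So the theorem reduces to the Erdos-Kac theorem for
   l <= Y.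

   That theorem is proved by moments.  Let W(l) be the sum over the primes
   p <= y of [p | l] - 1/p, with y = Y^(1/u) and u tending slowly to infinity.
   The power moments of W on [1, Y] and on one period [1, P], P the product of
   these primes, differ by O((2y)^j / Y).  On a period the indicators [p | l]
   are independent, so the means of cos(t + s W) and of exp(s W) are computed
   prime by prime; the second bounds the Taylor remainder of the cosine, which
   transfers the first to [1, Y].  Convergence of all trigonometric means and
   tightness give convergence of the distribution functions, since a step is
   approximated by a trigonometric polynomial (a polynomial in sin(x/M)).
   Finally sum_(p <= y) 1/p = ln ln y + O(1) by Mertens. *)
Require Import Defs.
From mathcomp Require Import measurable_realfun ring lra zify.

Set Implicit Arguments.
Unset Strict Implicit.
Unset Printing Implicit Defensive.

Local Open Scope classical_set_scope.
Local Open Scope ring_scope.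

(** * Averages over initial segments and moments *)

(** Gaussian moments are never computed: power moments only carry information from a period to
    [1, Y], where a polynomial in W has nearly the same mean on both. The cost (2y)^j / Y of this
    transfer forces y below every fixed power of Y, and the primes above y must then be negligible
    for each l. Cosines with an arbitrary phase take the place of complex characters: conditioning
    on one prime only shifts the phase, and a product of two such cosines is a sum of two others.
    The comparison of omega_h(n) with W(l) fails on two rare sets: small l, where ln ln n may be far
    from ln ln Y, and l divisible by the squares of many primes. The number of p with p^2 | l is not
    bounded, but its mean is at most 1, so Markov's inequality suffices. The limit for each fixed b
    does not give the limit of the sum over b, since the range of l shrinks as b grows. Hence the
    range for b is bounded by a summable weight times the range for b = 1, which is itself part of
    the count. *)

Definition avg (R : realType) (Y : nat) (f : nat -> R) : R :=
  (\sum_(1 <= l < Y.+1) f l) / Y%:R.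

Definition centered (R : realType) (ps : seq nat) (l : nat) : R :=
  \sum_(p <- ps) ((p %| l)%N%:R - p%:R^-1).

Lemma avgD (R : realType) Y (f g : nat -> R) :
  avg Y (fun l => f l + g l) = avg Y f + avg Y g.
Proof. by rewrite /avg big_split mulrDl. Qed.

Lemma avgZ (R : realType) Y (c : R) (f : nat -> R) :
  avg Y (fun l => c * f l) = c * avg Y f.
Proof. by rewrite /avg -mulr_sumr mulrA. Qed.

Lemma avgB (R : realType) Y (f g : nat -> R) :
  avg Y (fun l => f l - g l) = avg Y f - avg Y g.
Proof. by rewrite /avg sumrB mulrBl. Qed.

Lemma avg_sum (R : realType) Y I (s : seq I) (P : pred I) (f : I -> nat -> R) :
  avg Y (fun l => \sum_(i <- s | P i) f i l) = \sum_(i <- s | P i) avg Y (f i).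
Proof. by rewrite /avg exchange_big /= mulr_suml. Qed.

Lemma eq_avg (R : realType) Y (f g : nat -> R) :
  (forall l, (0 < l <= Y)%N -> f l = g l) -> avg Y f = avg Y g.
Proof. by move=> fg; rewrite /avg; congr (_ / _); apply: eq_big_nat. Qed.

Lemma le_avg (R : realType) Y (f g : nat -> R) :
  (forall l, (0 < l <= Y)%N -> f l <= g l) -> avg Y f <= avg Y g.
Proof.
move=> fg; rewrite /avg ler_wpM2r ?invr_ge0// big_nat_cond [leRHS]big_nat_cond.
by apply: ler_sum => l /andP[ly _]; exact: fg.
Qed.

Lemma avg_cst (R : realType) Y (c : R) : (0 < Y)%N -> avg Y (fun=> c) = c.
Proof.
move=> Y0; rewrite /avg sumr_const_nat subn1 /= -(mulr_natr c) mulfK//.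
by rewrite pnatr_eq0 -lt0n.
Qed.

Lemma ler_norm_avg (R : realType) Y (f : nat -> R) :
  `|avg Y f| <= avg Y (fun l => `|f l|).
Proof.
rewrite /avg normrM normfV normr_nat ler_wpM2r ?invr_ge0//.
exact: ler_norm_sum.
Qed.

Lemma avg_dvd (R : realType) Y d : avg Y (fun l => (d %| l)%N%:R : R) = (Y %/ d)%:R / Y%:R.
Proof. by rewrite /avg divn_count_dvd -natr_sum. Qed.

Lemma avg_dvd_exact (R : realType) P d : (0 < P)%N -> (d %| P)%N ->
  avg P (fun l => (d %| l)%N%:R : R) = d%:R^-1.
Proof.
move=> P0 dP; rewrite avg_dvd.
have d0 : (0 < d)%N by apply: dvdn_gt0 dP.
rewrite -{2}(divnK dP) natrM invfM mulrA divff ?mul1r//.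
by rewrite pnatr_eq0 -lt0n divn_gt0// dvdn_leq.
Qed.

Lemma avg_dvd_approx (R : realType) Y d : (0 < Y)%N -> (0 < d)%N ->
  `|avg Y (fun l => (d %| l)%N%:R : R) - d%:R^-1| <= Y%:R^-1.
Proof.
move=> Y0 d0; rewrite avg_dvd.
have Yr : (0 : R) < Y%:R by rewrite ltr0n.
have dr : (0 : R) < d%:R by rewrite ltr0n.
have E : (Y%:R : R) = (Y %/ d)%:R * d%:R + (Y %% d)%:R.
  by rewrite -natrM -natrD -divn_eq.
have -> : (Y %/ d)%:R / Y%:R - d%:R^-1 = - ((Y %% d)%:R / d%:R) / Y%:R :> R.
  have -> : (Y %% d)%:R = Y%:R - (Y %/ d)%:R * d%:R :> R by rewrite E; ring.
  by field; rewrite !gt_eqF.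
rewrite normrM normrN normfV (gtr0_norm Yr) ger_pMl ?invr_gt0//.
rewrite normrM normfV !normr_nat ler_pdivrMr// mul1r ler_nat.
exact/ltnW/ltn_pmod.
Qed.

(* For divisors d of P, the indicators of d | l have mean exactly 1/d on
   [1, P] and 1/d + O(1/Y) on [1, Y]; expanding one factor of the power at a
   time merges d with a prime into their lcm, again a divisor of P. *)
Lemma avg_centered_pow (R : realType) (ps : seq nat) P Y d j :
  (0 < P)%N -> (0 < Y)%N -> (d %| P)%N -> {in ps, forall p, (p %| P)%N} ->
  `|avg Y (fun l => (d %| l)%N%:R * centered R ps l ^+ j)
    - avg P (fun l => (d %| l)%N%:R * centered R ps l ^+ j)|
  <= (2 * size ps)%:R ^+ j / Y%:R.
Proof.
move=> P0 Y0 dP psP; elim: j d dP => [|j IH] d dP.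
  have E N : avg N (fun l => (d %| l)%N%:R * centered R ps l ^+ 0) =
             avg N (fun l => (d %| l)%N%:R).
    by apply: eq_avg => l _; rewrite expr0 mulr1.
  rewrite !E (avg_dvd_exact _ P0 dP) expr0 mul1r.
  by apply: avg_dvd_approx => //; exact: dvdn_gt0 dP.
have E N : avg N (fun l => (d %| l)%N%:R * centered R ps l ^+ j.+1) =
   \sum_(p <- ps) (avg N (fun l => (lcmn d p %| l)%N%:R * centered R ps l ^+ j)
     - p%:R^-1 * avg N (fun l => (d %| l)%N%:R * centered R ps l ^+ j)).
  under [RHS]eq_bigr => p _ do rewrite -avgZ -avgB.
  rewrite -avg_sum; apply: eq_avg => l _.
  rewrite exprS mulrCA {1}/centered mulr_suml; apply: eq_bigr => p _.
  by rewrite dvdn_lcm; case: (d %| l)%N; case: (p %| l)%N; rewrite /= ?mul1r ?mul0r; ring.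
rewrite !E -sumrB (le_trans (ler_norm_sum _ _ _))//.
have -> : (2 * size ps)%:R ^+ j.+1 / Y%:R =
  \sum_(p <- ps) (2 * ((2 * size ps)%:R ^+ j / Y%:R)) :> R.
  by rewrite big_const_seq iter_addr_0 count_predT exprS natrM -[RHS]mulr_natr; ring.
rewrite big_seq [leRHS]big_seq; apply: ler_sum => p pps.
set a := avg Y _; set b := avg Y _; set a' := avg P _; set b' := avg P _.
have -> : a - p%:R^-1 * b - (a' - p%:R^-1 * b') = (a - a') - p%:R^-1 * (b - b').
  by ring.
rewrite (le_trans (ler_normB _ _))// mulrDl mul1r lerD//.
  by apply: IH; rewrite dvdn_lcm dP psP.
rewrite normrM (le_trans _ (IH _ dP))// ler_piMl//.
have p0 : (0 < p)%N by exact: dvdn_gt0 (psP _ pps).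
by rewrite normfV normr_nat invf_le1 ?ltr0n// ler1n.
Qed.

Lemma sum_periodic (R : realType) (g : nat -> R) P m :
  (forall l, g (l + P)%N = g l) ->
  \sum_(1 <= l < (m * P).+1) g l = m%:R * \sum_(1 <= l < P.+1) g l.
Proof.
move=> gP; elim: m => [|m IH]; first by rewrite mul0n big_geq// mul0r.
rewrite (big_cat_nat (n := (m * P).+1))//=; last first.
  by rewrite ltnS leq_mul2r leqnSn orbT.
rewrite IH -[m.+1]addn1 natrD mulrDl mul1r; congr (_ + _).
have gmP l : g (l + m * P)%N = g l.
  by elim: (m) l => [|k IHk] l; rewrite ?addn0// mulSn addnA IHk gP.
rewrite -{1}[(m * P).+1]add1n big_addn addn1 mulSn -addSn addnK.
by apply: eq_bigr => l _; rewrite gmP.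
Qed.

Lemma sum_multiples (R : realType) (g : nat -> R) p P : (0 < p)%N ->
  \sum_(1 <= l < (p * P).+1) (p %| l)%N%:R * g l =
  \sum_(1 <= m < P.+1) g (p * m)%N.
Proof.
move=> p0; elim: P => [|P IH]; first by rewrite muln0 !big_geq.
rewrite (big_cat_nat (n := (p * P).+1))//=; last by rewrite ltnS leq_mul2l leqnSn orbT.
rewrite IH [RHS]big_nat_recr//=; congr (_ + _).
have lt : (p * P < p * P.+1)%N by rewrite ltn_mul2l p0 ltnSn.
rewrite (big_nat_recr _ _ _ lt)/=.
rewrite dvdn_mulr// mul1r big_nat_cond big1 ?add0r// => l.
rewrite andbT => /andP[l1 l2].
have -> : (p %| l)%N = false; last by rewrite mul0r.
apply/negP => /dvdnP[c E]; move: l1 l2; rewrite E (mulnC c) !ltn_mul2l p0 /=.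
by rewrite ltnS; case: ltngtP.
Qed.

Lemma centered_periodic (R : realType) ps P l : {in ps, forall p, (p %| P)%N} ->
  centered R ps (l + P) = centered R ps l.
Proof.
move=> psP; rewrite /centered big_seq [RHS]big_seq; apply: eq_bigr => p pps.
by rewrite dvdn_addl// psP.
Qed.

Lemma centered_mull (R : realType) ps p l : {in ps, forall q, coprime q p} ->
  centered R ps (p * l) = centered R ps l.
Proof.
move=> psp; rewrite /centered big_seq [RHS]big_seq; apply: eq_bigr => q qps.
by rewrite Gauss_dvdr// psp.
Qed.

Definition prodn (ps : seq nat) : nat := \prod_(p <- ps) p.

Lemma dvdn_prodn ps : {in ps, forall p, (p %| prodn ps)%N}.
Proof. by move=> p pps; rewrite /prodn (big_rem p)//= dvdn_mulr. Qed.

Lemma seqprod_gt0 ps : all prime ps -> (0 < prodn ps)%N.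
Proof.
move=> /allP psp; rewrite /prodn big_seq; apply: prodn_cond_gt0 => p /psp.
exact: prime_gt0.
Qed.

Lemma primes_coprime p ps : all prime (p :: ps) -> uniq (p :: ps) ->
  {in ps, forall q, coprime q p}.
Proof.
move=> /= /andP[p_pr /allP psp] /andP[pps _] q qps.
rewrite (prime_coprime _ (psp _ qps)) (dvdn_prime2 (psp _ qps) p_pr).
by apply: contra pps => /eqP <-.
Qed.

(* Modulo the product of the primes, divisibility by them is a sequence of
   independent Bernoulli variables (Chinese remainders). *)
Lemma avg_centered_cons (R : realType) (g : R -> R) p ps :
  all prime (p :: ps) -> uniq (p :: ps) ->
  let q : R := p%:R^-1 in
  avg (prodn (p :: ps)) (fun l => g (centered R (p :: ps) l)) =
  (1 - q) * avg (prodn ps) (fun l => g (centered R ps l - q)) +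
  q * avg (prodn ps) (fun l => g (centered R ps l + (1 - q))).
Proof.
move=> pps ups q; have cop := primes_coprime pps ups.
move: (pps) => /= /andP[pp psp]; have p0 := prime_gt0 pp.
have P0 := seqprod_gt0 psp; set P := prodn ps.
have -> : prodn (p :: ps) = (p * P)%N by rewrite /prodn big_cons.
set g0 := fun l => g (centered R ps l - q).
set g1 := fun l => g (centered R ps l + (1 - q)).
have g0P l : g0 (l + P)%N = g0 l.
  by rewrite /g0 centered_periodic//; exact: dvdn_prodn.
(* The first term averages over p periods of length P. In the second only l = p m survives, and
   multiplication by p, coprime to the other primes, does not change [centered R ps]. *)
have E l : g (centered R (p :: ps) l) = g0 l + (p %| l)%N%:R * (g1 l - g0 l).
  rewrite /g0 /g1 /centered big_cons -/(centered R ps l) -/q.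
  rewrite addrC; case: (p %| l)%N; first by rewrite mul1r [RHS]addrC subrK.
  by rewrite sub0r mul0r addr0.
rewrite (eq_avg (fun l _ => E l)) avgD.
have -> : avg (p * P) g0 = avg P g0.
  rewrite /avg sum_periodic// natrM; have : (p%:R : R) != 0 by rewrite pnatr_eq0 -lt0n.
  have : (P%:R : R) != 0 by rewrite pnatr_eq0 -lt0n.
  by move=> ? ?; field; apply/andP.
have -> : avg (p * P) (fun l => (p %| l)%N%:R * (g1 l - g0 l)) = q * (avg P g1 - avg P g0).
  rewrite /avg sum_multiples// -mulrBl -sumrB natrM invfM mulrCA -/q.
  congr (_ * (_ * _)); apply: eq_bigr => m _.
  by rewrite /g1 /g0 centered_mull.
by ring.
Qed.

(** * Trigonometric means over a period *)

Lemma ge0_derive_le (R : realType) (f df : R -> R) (x : R) :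
  (forall y : R, is_derive y 1 f (df y)) -> (forall y, 0 <= y -> 0 <= df y) ->
  0 <= x -> f 0 <= f x.
Proof.
move=> fd df0 x0; rewrite -subr_ge0.
have cf : {within `[0, x], continuous f}.
  apply: continuous_subspaceT => y; apply: differentiable_continuous.
  by apply/derivable1_diffP; have [] := fd y.
have [c + ->] := MVT_segment x0 (fun y _ => fd y) cf.
by rewrite in_itv/= => /andP[c0 _]; rewrite mulr_ge0 ?subr_ge0// df0.
Qed.

Lemma is_derive_monom (R : realType) (c z : R) k :
  is_derive z 1 (fun x : R => c * x ^+ k.+1 / k.+1`!%:R) (c * z ^+ k / k`!%:R).
Proof.
have := is_deriveZ (c / k.+1`!%:R) (is_deriveX k.+1 (is_derive_id z (1 : R))).
rewrite [X in is_derive _ _ X _](_ : _ = fun x => c * x ^+ k.+1 / k.+1`!%:R); last first.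
  by apply/funext => x; rewrite !fctE /= /GRing.scale/= mulrAC.
rewrite [X in is_derive _ _ _ X](_ : _ = c * z ^+ k / k`!%:R)//.
rewrite /GRing.scale/= mulr1 factS natrM; field.
by rewrite !pnatr_eq0 -!lt0n fact_gt0 /=.
Qed.

Lemma le_norm_derive_pow_ge0 (R : realType) k (f df : R -> R) (x : R) : 0 <= x ->
  (forall y : R, is_derive y 1 f (df y)) -> f 0 = 0 ->
  (forall y, `|df y| <= `|y| ^+ k / k`!%:R) ->
  `|f x| <= `|x| ^+ k.+1 / k.+1`!%:R.
Proof.
move=> x0 fd f0 dfk; rewrite (ger0_norm x0).
have dpow (z : R) : is_derive z 1 (fun z : R => z ^+ k.+1 / k.+1`!%:R) (z ^+ k / k`!%:R).
  have := is_derive_monom 1 z k; rewrite mul1r.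
  by under eq_fun do rewrite mul1r.
rewrite ler_norml -subr_ge0 opprK -[X in _ && X]subr_ge0; apply/andP; split.
  have := @ge0_derive_le R (fun z => f z + z ^+ k.+1 / k.+1`!%:R)
    (fun z => df z + z ^+ k / k`!%:R) x.
  rewrite f0 expr0n/= mul0r addr0; apply=> // z z0.
  by have := dfk z; rewrite (ger0_norm z0) ler_norml -subr_ge0 opprK => /andP[].
have := @ge0_derive_le R (fun z => z ^+ k.+1 / k.+1`!%:R - f z)
    (fun z => z ^+ k / k`!%:R - df z) x.
rewrite f0 expr0n/= mul0r subr0; apply=> // z z0.
by have := dfk z; rewrite (ger0_norm z0) ler_norml subr_ge0 => /andP[].
Qed.

Lemma is_derive_compN (R : realType) (f : R -> R) (y df : R) :
  is_derive (- y) 1 f df -> is_derive y 1 (fun y => f (- y)) (- df).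
Proof.
move=> fd; have := @is_derive1_comp R f -%R y df (-1) fd.
by rewrite mulrN1; apply.
Qed.

Lemma le_norm_derive_pow (R : realType) k (f df : R -> R) :
  (forall y : R, is_derive y 1 f (df y)) -> f 0 = 0 ->
  (forall y, `|df y| <= `|y| ^+ k / k`!%:R) ->
  forall x, `|f x| <= `|x| ^+ k.+1 / k.+1`!%:R.
Proof.
move=> fd f0 dfk x; have [x0|x0] := leP 0 x; first exact: le_norm_derive_pow_ge0 dfk.
have := @le_norm_derive_pow_ge0 R k (fun y => f (- y)) (fun y => - df (- y)) (- x).
rewrite oppr0 opprK normrN; apply; rewrite ?oppr_ge0 ?ltW// => y.
  exact: is_derive_compN.
by rewrite normrN -(normrN y) dfk.
Qed.

(** Taylor polynomial of cos at t with k terms. Writing the j-th derivative as cos(t + j pi/2)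
    avoids a case distinction modulo 4. *)
Definition cosT (R : realType) k (t x : R) : R :=
  \sum_(j < k) cos (t + (pi / 2) *+ j) * x ^+ j / j`!%:R.

(** The remainder of order k + 1 at t vanishes at 0, and its derivative is the remainder of order k
    at t + pi/2; the induction starts from |cos| <= 1. *)
Lemma cos_taylor (R : realType) k (t x : R) :
  `|cos (t + x) - cosT k t x| <= `|x| ^+ k / k`!%:R.
Proof.
elim: k t x => [|k IH] t x.
  by rewrite /cosT big_ord0 subr0 expr0 fact0 divr1 cos_max.
apply: (@le_norm_derive_pow R k (fun x => cos (t + x) - cosT k.+1 t x)
   (fun x => cos (t + pi / 2 + x) - cosT k (t + pi / 2) x)) => [y||y]; last exact: IH.
  apply: is_deriveB.
    have := @is_derive1_comp R cos (shift t) y _ 1 (is_derive_cos _) (is_derive_shift y 1 t).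
    rewrite [X in is_derive _ _ X _](_ : _ = fun x => cos (t + x)); last first.
      by apply/funext => z /=; rewrite addrC.
    by rewrite mulr1 -cosDpihalf /shift/= (addrC y) addrAC.
  have -> : cosT k.+1 t = fun x => cos t + \sum_(j < k) cos (t + (pi / 2) *+ j.+1) * x ^+ j.+1 / j.+1`!%:R.
    by apply/funext => z; rewrite /cosT big_ord_recl/= mulr0n addr0 expr0 fact0 divr1 mulr1.
  have -> : cosT k (t + pi / 2) y = 0 + \sum_(j < k) cos (t + (pi / 2) *+ j.+1) * y ^+ j / j`!%:R.
    by rewrite add0r; apply: eq_bigr => j _; rewrite (mulrS (pi / 2)) addrA.
  apply: is_deriveD.
  rewrite (_ : (fun x => _) = \sum_(j < k) (fun x => cos (t + (pi / 2) *+ j.+1) * x ^+ j.+1 / j.+1`!%:R)); last first.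
    by apply/funext => z; rewrite fct_sumE.
  apply: is_derive_sum => j.
  exact: is_derive_monom.
rewrite addr0 /cosT big_ord_recl/= mulr0n addr0 expr0 fact0 divr1 mulr1 big1 ?addr0 ?subrr// => j _.
by rewrite expr0n/= mulr0 mul0r.
Qed.

Lemma expRN_approx (R : realType) (v : R) : 0 <= v ->
  `|expR (- v) - (1 - v)| <= v ^+ 2.
Proof.
move=> v0; have l := expR_ge1Dx (- v); have u := expR_ge1Dx v.
have e0 := expR_gt0 (- v).
have : expR v * expR (- v) = 1 by exact: expRxMexpNx_1.
move=> E; rewrite ger0_norm; last lra.
have : (1 + v) * expR (- v) <= 1 by rewrite -[leRHS]E ler_wpM2r// ltW.
nra.
Qed.

Lemma expR_le_quadratic (R : realType) (s : R) : `|s| <= 2^-1 ->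
  expR s <= 1 + s + 2 * s ^+ 2.
Proof.
rewrite ler_norml => /andP[s1 s2].
have u := expR_ge1Dx (- s); have e0 := expR_gt0 s.
have E : expR s * expR (- s) = 1 by exact: expRxMexpNx_1.
have : (1 - s) * expR s <= 1 by rewrite -[leRHS]E mulrC ler_wpM2l// ltW.
nra.
Qed.

Lemma cosT3 (R : realType) (t x : R) :
  cosT 3 t x = cos t - sin t * x - cos t * x ^+ 2 / 2.
Proof.
rewrite /cosT !big_ord_recr big_ord0/= add0r mulr0n addr0 expr0 fact0 divr1 mulr1.
rewrite mulr1n cosDpihalf expr1 divr1 mulNr; congr (_ + _).
have -> : (pi / 2) *+ 2 = pi :> R by rewrite -mulr_natr divfK// pnatr_eq0.
by rewrite cosDpi !mulNr.
Qed.

(** One prime's factor of the characteristic function: a centered Bernoulli variable of parameter q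
    against a Gaussian of variance q. *)
Lemma bernoulli_cos (R : realType) (s q t : R) : `|s| <= 1 -> 0 <= q <= 1 ->
  `|(1 - q) * cos (t - s * q) + q * cos (t + s * (1 - q))
    - expR (- (s ^+ 2 * q / 2)) * cos t| <= `|s| ^+ 3 * q + s ^+ 2 * q ^+ 2.
Proof.
move=> s1 /andP[q0 q1].
have := cos_taylor 3 t (- (s * q)); have := cos_taylor 3 t (s * (1 - q)).
have := @expRN_approx R (s ^+ 2 * q / 2); rewrite !cosT3.
set a := cos (t - s * q); set b := cos (t + s * (1 - q)); set e := expR _.
have a1 : `|cos t| <= 1 := cos_max t.
have s2 : `|s| ^+ 2 = s ^+ 2 by rewrite real_normK// num_real.
have s20 : 0 <= s ^+ 2 := sqr_ge0 s.
have s21 : s ^+ 2 <= 1 by rewrite -s2 exprn_ile1 ?normr_ge0.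
have v0 : 0 <= s ^+ 2 * q / 2 by rewrite divr_ge0// mulr_ge0.
move=> /(_ v0).
set u := `|s| in s1 s2 *.
have u0 : 0 <= u by rewrite normr_ge0.
have fE : (3`!)%:R = 6 :> R by [].
rewrite !normrM normrN normrM -/u (ger0_norm q0) (_ : `|1 - q| = 1 - q); last first.
  by rewrite ger0_norm// subr_ge0.
rewrite fE => He Hb Ha.
pose Ra := a - (cos t - sin t * - (s * q) - cos t * (- (s * q)) ^+ 2 / 2).
pose Rb := b - (cos t - sin t * (s * (1 - q)) - cos t * (s * (1 - q)) ^+ 2 / 2).
(* The sine terms cancel because the variable is centered. Its variance is q (1 - q) while the
   exponent uses q; this accounts for the term in q^2. *)
have -> : (1 - q) * a + q * b - e * cos t =
  (1 - q) * Ra + q * Rb + cos t * s ^+ 2 * q ^+ 2 / 2 -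
  (e - (1 - s ^+ 2 * q / 2)) * cos t.
  by rewrite /Ra /Rb; field.
have H1 : `|(1 - q) * Ra| <= u ^+ 3 * q / 6.
  rewrite normrM ger0_norm ?subr_ge0//.
  apply: (@le_trans _ _ (1 * ((u * q) ^+ 3 / 6))).
    by apply: ler_pM; rewrite ?subr_ge0// lerBlDr lerDl.
  rewrite mul1r ler_pM2r ?invr_gt0// exprMn ler_wpM2l ?exprn_ge0//.
  by rewrite exprS ler_piMr// exprn_ile1.
have H2 : `|q * Rb| <= u ^+ 3 * q / 6.
  rewrite normrM ger0_norm//.
  apply: (@le_trans _ _ (q * ((u * (1 - q)) ^+ 3 / 6))).
    by rewrite ler_wpM2l.
  rewrite mulrA ler_pM2r ?invr_gt0// mulrC ler_wpM2r// exprMn ler_piMr ?exprn_ge0//.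
  by rewrite exprn_ile1 ?subr_ge0// lerBlDr lerDl.
have H3 : `|cos t * s ^+ 2 * q ^+ 2 / 2| <= s ^+ 2 * q ^+ 2 / 2.
  have w0 : 0 <= s ^+ 2 * q ^+ 2 / 2 by rewrite divr_ge0// mulr_ge0// sqr_ge0.
  have -> : cos t * s ^+ 2 * q ^+ 2 / 2 = cos t * (s ^+ 2 * q ^+ 2 / 2) by ring.
  by rewrite normrM (ger0_norm w0) ler_piMl.
have H4 : `|(e - (1 - s ^+ 2 * q / 2)) * cos t| <= s ^+ 2 * q ^+ 2 / 4.
  rewrite normrM; apply: (@le_trans _ _ ((s ^+ 2 * q / 2) ^+ 2 * 1)).
    by apply: ler_pM.
  rewrite mulr1 !exprMn (_ : 2^-1 ^+ 2 = 4^-1); last by field.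
  rewrite ler_pM2r ?invr_gt0// ler_wpM2r ?sqr_ge0// expr2 ler_piMr//.
rewrite (le_trans (ler_normB _ _))// (le_trans (lerD (ler_normD _ _) (lexx _)))//.
rewrite (le_trans (lerD (lerD (ler_normD _ _) (lexx _)) (lexx _)))//.
have : 0 <= u ^+ 3 * q by rewrite mulr_ge0// exprn_ge0.
have : 0 <= s ^+ 2 * q ^+ 2 by rewrite mulr_ge0// sqr_ge0.
lra.
Qed.

(** With expR s <= 1 + s + 2 s^2, the mean of the uncentered variable is at most exp(q (s + 2 s^2)),
    and centering removes the linear part q s. *)
Lemma bernoulli_expR (R : realType) (s q : R) : `|s| <= 2^-1 -> 0 <= q <= 1 ->
  (1 - q) * expR (- (s * q)) + q * expR (s * (1 - q)) <= expR (2 * s ^+ 2 * q).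
Proof.
move=> s1 /andP[q0 q1].
have -> : (1 - q) * expR (- (s * q)) + q * expR (s * (1 - q)) =
  (1 + q * (expR s - 1)) * expR (- (s * q)).
  by rewrite (_ : s * (1 - q) = s + - (s * q)) ?expRD; ring.
have e1 : 1 + q * (expR s - 1) <= expR (q * (s + 2 * s ^+ 2)).
  apply: le_trans (expR_ge1Dx _); rewrite lerD2l ler_wpM2l//.
  by have := expR_le_quadratic s1; lra.
apply: le_trans (ler_wpM2r (expR_ge0 _) e1) _.
by rewrite -expRD ler_expR; lra.
Qed.

Definition recip_sum (R : realType) (ps : seq nat) : R := \sum_(p <- ps) p%:R^-1.

Definition recip_sqr_sum (R : realType) (ps : seq nat) : R :=
  \sum_(p <- ps) p%:R^-1 ^+ 2.

Lemma invn_itv (R : realType) (p : nat) : 0 <= (p%:R^-1 : R) <= 1.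
Proof.
rewrite invr_ge0 ler0n/=; case: p => [|p]; first by rewrite invr0.
by rewrite invf_le1 ?ltr0n// ler1n.
Qed.

Lemma avg_nil (R : realType) (g : R -> R) :
  avg (prodn [::]) (fun l => g (centered R [::] l)) = g 0.
Proof. by rewrite /avg /prodn /centered !big_nil big_nat1 divr1 big_nil. Qed.

Lemma avg_centered_expR (R : realType) (s : R) ps :
  all prime ps -> uniq ps -> `|s| <= 2^-1 ->
  avg (prodn ps) (fun l => expR (s * centered R ps l)) <=
  expR (2 * s ^+ 2 * recip_sum R ps).
Proof.
move=> + + s1; elim: ps => [|p ps IH] pps ups.
  by rewrite (avg_nil (fun x => expR (s * x))) /recip_sum big_nil !mulr0.
rewrite (avg_centered_cons (fun x => expR (s * x)) pps ups).
move: pps ups => /= /andP[pp psp] /andP[pps ups]; set q := p%:R^-1.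
have E c : avg (prodn ps) (fun l => expR (s * (centered R ps l + c))) =
    expR (s * c) * avg (prodn ps) (fun l => expR (s * centered R ps l)).
  by rewrite -avgZ; apply: eq_avg => l _; rewrite mulrDr addrC expRD.
rewrite !E mulrN; set A := avg _ _.
have -> : expR (2 * s ^+ 2 * recip_sum R (p :: ps)) =
    expR (2 * s ^+ 2 * q) * expR (2 * s ^+ 2 * recip_sum R ps).
  by rewrite -expRD -mulrDr /recip_sum big_cons.
rewrite !(mulrA _ _ A) -mulrDl.
have q01 : 0 <= q <= 1 := invn_itv R p.
apply: ler_pM => //; [| |exact: bernoulli_expR|exact: IH].
  by move: q01 => /andP[? ?]; rewrite addr_ge0// mulr_ge0 ?expR_ge0// subr_ge0.
by rewrite /avg divr_ge0// sumr_ge0// => l _; exact: expR_ge0.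
Qed.

(** The induction needs all t, as conditioning on p moves the phase by - s q or s (1 - q). Errors
    add up without growth because the Gaussian factor of the remaining primes is at most 1. *)
Lemma avg_centered_cos (R : realType) (s t : R) ps :
  all prime ps -> uniq ps -> `|s| <= 1 ->
  `|avg (prodn ps) (fun l => cos (t + s * centered R ps l))
    - expR (- (s ^+ 2 * recip_sum R ps / 2)) * cos t| <=
  `|s| ^+ 3 * recip_sum R ps + s ^+ 2 * recip_sqr_sum R ps.
Proof.
move=> + + s1; elim: ps t => [|p ps IH] t pps ups.
  rewrite (avg_nil (fun x => cos (t + s * x))) /recip_sum /recip_sqr_sum !big_nil.
  by rewrite !mulr0 !mul0r addr0 oppr0 expR0 mul1r addr0 subrr normr0.
rewrite (avg_centered_cons (fun x => cos (t + s * x)) pps ups).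
move: pps ups => /= /andP[pp psp] /andP[pps ups]; set q := p%:R^-1.
have E c : avg (prodn ps) (fun l => cos (t + s * (centered R ps l + c))) =
    avg (prodn ps) (fun l => cos (t + s * c + s * centered R ps l)).
  by apply: eq_avg => l _; rewrite mulrDr addrA addrAC.
have q01 : 0 <= q <= 1 := invn_itv R p.
have := bernoulli_cos t s1 q01; rewrite !E mulrN.
have := IH (t - s * q) psp ups; have := IH (t + s * (1 - q)) psp ups.
rewrite /recip_sum /recip_sqr_sum !big_cons -/(recip_sum R ps) -/(recip_sqr_sum R ps) -/q.
set a := avg _ _; set b := avg _ _; set mu := recip_sum R ps; set nu := recip_sqr_sum R ps.
set e := expR (- (s ^+ 2 * mu / 2)); set ca := cos (t + s * (1 - q)); set cb := cos (t - _).
move=> Ha Hb Hc.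
have -> : expR (- (s ^+ 2 * (q + mu) / 2)) = e * expR (- (s ^+ 2 * q / 2)).
  by rewrite -expRD; congr expR; ring.
move: Hc; set f := expR (- (s ^+ 2 * q / 2)) => Hc.
have e0 : 0 <= e by exact: expR_ge0.
have e1 : e <= 1.
  by rewrite expR_le1 oppr_le0 divr_ge0// mulr_ge0 ?sqr_ge0// sumr_ge0//.
move: q01 => /andP[q0 q1].
have -> : (1 - q) * b + q * a - e * f * cos t =
  (1 - q) * (b - e * cb) + q * (a - e * ca) + e * ((1 - q) * cb + q * ca - f * cos t).
  by ring.
rewrite (le_trans (ler_normD _ _))// (le_trans (lerD (ler_normD _ _) (lexx _)))//.
rewrite !normrM (ger0_norm q0) (ger0_norm e0) (@ger0_norm _ (1 - q)) ?subr_ge0//.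
have := ler_wpM2l q0 Ha.
have := @ler_wpM2l R (1 - q) _ _ _ Hb; rewrite subr_ge0 => /(_ q1).
have := ler_pM e0 (normr_ge0 _) e1 Hc.
set X1 := `|b - _|; set X2 := `|a - _|; set X3 := `|_ - f * _|.
set k3 := `|s| ^+ 3; set k2 := s ^+ 2.
nra.
Qed.

(** * Transfer from a period to an initial segment *)

Lemma pow_fact_le_expR (R : realType) (x : R) k :
  x ^+ k.*2 / k.*2`!%:R <= expR x + expR (- x).
Proof.
wlog x0 : x / 0 <= x.
  move=> H; have [x0|x0] := leP 0 x; first exact: H.
  have := H (- x); rewrite oppr_ge0 opprK addrC; rewrite exprNn -signr_odd odd_double mul1r.
  by apply; exact: ltW.
have e0 := expR_gt0 (- x).
case: k => [|k].
  rewrite expr0 fact0 divr1; have := expR_ge1Dx x; lra.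
have := @expR_ge1Dxn R x (k.*2).+1 x0; rewrite doubleS; lra.
Qed.

Lemma avg_prod_even_moment (R : realType) (s : R) ps k :
  all prime ps -> uniq ps -> `|s| <= 2^-1 ->
  avg (prodn ps) (fun l => (s * centered R ps l) ^+ k.*2 / k.*2`!%:R) <=
  2 * expR (2 * s ^+ 2 * recip_sum R ps).
Proof.
move=> pps ups s1.
apply: (@le_trans _ _ (avg (prodn ps) (fun l => expR (s * centered R ps l) +
    expR (- s * centered R ps l)))).
  by apply: le_avg => l _; rewrite mulNr pow_fact_le_expR.
rewrite avgD mulrDl mul1r; apply: lerD; first exact: avg_centered_expR.
by rewrite -sqrrN; apply: avg_centered_expR => //; rewrite normrN.
Qed.

Lemma avg_centered_pow1 (R : realType) (ps : seq nat) Y j :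
  all prime ps -> (0 < Y)%N ->
  `|avg Y (fun l => centered R ps l ^+ j)
    - avg (prodn ps) (fun l => centered R ps l ^+ j)|
  <= (2 * size ps)%:R ^+ j / Y%:R.
Proof.
move=> pps Y0; have P0 := seqprod_gt0 pps.
have := @avg_centered_pow R ps (prodn ps) Y 1 j P0 Y0 (dvd1n _) (@dvdn_prodn ps).
have E N : avg N (fun l => (1 %| l)%N%:R * centered R ps l ^+ j) =
  avg N (fun l => centered R ps l ^+ j).
  by apply: eq_avg => l _; rewrite dvd1n mul1r.
by rewrite !E.
Qed.

Lemma avg_even_moment (R : realType) (s : R) ps k Y :
  all prime ps -> uniq ps -> `|s| <= 2^-1 -> (0 < Y)%N ->
  avg Y (fun l => (s * centered R ps l) ^+ k.*2 / k.*2`!%:R) <=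
  avg (prodn ps) (fun l => (s * centered R ps l) ^+ k.*2 / k.*2`!%:R) +
  (2 * size ps)%:R ^+ k.*2 / Y%:R.
Proof.
move=> pps ups s1 Y0; rewrite -lerBlDl.
set c := s ^+ k.*2 / k.*2`!%:R.
have E N : avg N (fun l => (s * centered R ps l) ^+ k.*2 / k.*2`!%:R) =
  c * avg N (fun l => centered R ps l ^+ k.*2).
  by rewrite -avgZ; apply: eq_avg => l _; rewrite exprMn /c mulrAC.
rewrite !E -mulrBr (le_trans (ler_norm _))// normrM.
have c1 : `|c| <= 1.
  rewrite /c normrM normfV normr_nat ler_pdivrMr ?ltr0n ?fact_gt0// mul1r.
  rewrite normrX (@le_trans _ _ 1)// ?ler1n ?fact_gt0// exprn_ile1//.
  by rewrite (le_trans s1)// invf_le1// ler1n.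
rewrite -[leRHS]mul1r; apply: ler_pM => //; exact: avg_centered_pow1.
Qed.

(** For an even order m = 2k the Taylor remainder is bounded by a power of W without absolute value,
    so the remainder on [1, Y] is itself transferred to the period. The m Taylor terms and this
    remainder make m + 1 transfers, each of cost at most (2 size)^m / Y. *)
Lemma avg_cos_cmp (R : realType) (s t : R) ps k Y :
  all prime ps -> uniq ps -> `|s| <= 2^-1 -> (0 < Y)%N -> (0 < size ps)%N ->
  `|avg Y (fun l => cos (t + s * centered R ps l))
    - avg (prodn ps) (fun l => cos (t + s * centered R ps l))| <=
  (k.*2.+1)%:R * (2 * size ps)%:R ^+ k.*2 / Y%:R +
  2 * avg (prodn ps) (fun l => (s * centered R ps l) ^+ k.*2 / k.*2`!%:R).
Proof.
move=> pps ups s1 Y0 n0.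
have sle1 : `|s| <= 1 by rewrite (le_trans s1)// invf_le1// ler1n.
set W := centered R ps; set P := prodn ps.
pose T N := avg N (fun l => cosT k.*2 t (s * W l)).
pose M N := avg N (fun l => (s * W l) ^+ k.*2 / k.*2`!%:R).
have err N : `|avg N (fun l => cos (t + s * W l)) - T N| <= M N.
  rewrite /T -avgB (le_trans (ler_norm_avg _ _))//; apply: le_avg => l _.
  rewrite (le_trans (cos_taylor _ _ _))// -normrX ger0_norm//.
  by rewrite exprn_even_ge0// odd_double.
set D : R := (2 * size ps)%:R; set m := k.*2 in T M err *.
have D1 : 1 <= D by rewrite ler1n muln_gt0.
have TT : `|T Y - T P| <= m%:R * D ^+ m / Y%:R.
  have E N : T N = \sum_(j < m) (cos (t + (pi / 2) *+ j) * s ^+ j / j`!%:R) *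
      avg N (fun l => W l ^+ j).
    under [RHS]eq_bigr => j _ do rewrite -avgZ.
    rewrite -avg_sum; apply: eq_avg => l _; apply: eq_bigr => j _.
    by rewrite exprMn; ring.
  rewrite !E -sumrB (le_trans (ler_norm_sum _ _ _))//.
  have -> : m%:R * D ^+ m / Y%:R = \sum_(j < m) D ^+ m / Y%:R.
    by rewrite sumr_const card_ord -mulrA mulr_natl.
  apply: ler_sum => j _; rewrite -mulrBr normrM -[leRHS]mul1r.
  apply: ler_pM => //.
    rewrite !normrM normfV normr_nat ler_pdivrMr ?ltr0n ?fact_gt0// mul1r normrX.
    rewrite (@le_trans _ _ 1) ?ler1n ?fact_gt0//.
    by rewrite mulr_ile1 ?exprn_ge0// ?cos_max// exprn_ile1.
  rewrite (le_trans (avg_centered_pow1 _ _ pps Y0))// ler_wpM2r ?invr_ge0//.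
  by rewrite ler_weXn2l// ltnW.
have eM := avg_even_moment k pps ups s1 Y0; rewrite -/P -/W -/m in eM.
have := err Y; have := err P; move: TT eM; rewrite -/(M Y) -/(M P) -/D.
have -> : m.+1%:R * D ^+ m / Y%:R = m%:R * D ^+ m / Y%:R + D ^+ m / Y%:R.
  by rewrite -natr1; ring.
rewrite !ler_norml; lra.
Qed.

Lemma avg_cos_approx (R : realType) (s t : R) ps k Y :
  all prime ps -> uniq ps -> `|s| <= 4^-1 -> (0 < Y)%N -> (0 < size ps)%N ->
  `|avg Y (fun l => cos (t + s * centered R ps l))
    - expR (- (s ^+ 2 * recip_sum R ps / 2)) * cos t| <=
  (k.*2.+1)%:R * (2 * size ps)%:R ^+ k.*2 / Y%:R +
  4 * 4^-1 ^+ k * expR (8 * s ^+ 2 * recip_sum R ps) +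
  `|s| ^+ 3 * recip_sum R ps + s ^+ 2 * recip_sqr_sum R ps.
Proof.
move=> pps ups s1 Y0 n0.
have s2 : `|s| <= 2^-1 by lra.
have s3 : `|s| <= 1 by lra.
have := avg_cos_cmp t k pps ups s2 Y0 n0.
have := avg_centered_cos t pps ups s3.
(* The moment bound is applied to 2 s instead of s, which gains 4^-k: the remainder is small for a k
   that does not depend on Y. It needs |2 s| <= 1/2, hence |s| <= 1/4. *)
have : avg (prodn ps) (fun l => (s * centered R ps l) ^+ k.*2 / k.*2`!%:R) <=
  4^-1 ^+ k * (2 * expR (8 * s ^+ 2 * recip_sum R ps)).
  have -> : 8 * s ^+ 2 = 2 * (2 * s) ^+ 2 by ring.
  have -> : avg (prodn ps) (fun l => (s * centered R ps l) ^+ k.*2 / k.*2`!%:R) =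
    4^-1 ^+ k * avg (prodn ps) (fun l => ((2 * s) * centered R ps l) ^+ k.*2 / k.*2`!%:R).
    have H (x : R) : (2 * x) ^+ k.*2 = 4 ^+ k * x ^+ k.*2.
      by rewrite exprMn -mul2n exprM; congr (_ ^+ _ * _); ring.
    rewrite -avgZ; apply: eq_avg => l _.
    by rewrite -(mulrA 2 s) H !mulrA -exprMn mulVf ?expr1n ?mul1r ?pnatr_eq0.
  rewrite ler_wpM2l ?exprn_ge0 ?invr_ge0//; apply: avg_prod_even_moment => //.
  by rewrite normrM ger0_norm//; lra.
set a := avg Y _; set b := avg _ _; set c := avg _ _; set e := expR _; set e' := expR _.
rewrite !ler_norml; lra.
Qed.

Lemma avg_centered_sqr (R : realType) (s : R) ps Y :
  all prime ps -> uniq ps -> `|s| <= 2^-1 -> (0 < Y)%N ->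
  avg Y (fun l => (s * centered R ps l) ^+ 2) <=
  4 * expR (2 * s ^+ 2 * recip_sum R ps) + 2 * (2 * size ps)%:R ^+ 2 / Y%:R.
Proof.
move=> pps ups s1 Y0.
have := avg_even_moment 1 pps ups s1 Y0; have := avg_prod_even_moment 1 pps ups s1.
have E : avg Y (fun l => (s * centered R ps l) ^+ 1.*2 / 1.*2`!%:R) =
   2^-1 * avg Y (fun l => (s * centered R ps l) ^+ 2).
  by rewrite -avgZ; apply: eq_avg => l _; rewrite mulrC.
rewrite E -[1.*2]/2%N; lra.
Qed.

(** * The theorems of Chebyshev and Mertens *)

Lemma prodn_dvd ps N : all prime ps -> uniq ps -> {in ps, forall p, (p %| N)%N} ->
  (prodn ps %| N)%N.
Proof.
elim: ps => [|p ps IH] pps ups psN; first by rewrite /prodn big_nil dvd1n.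
rewrite /prodn big_cons -/(prodn ps).
have cop := primes_coprime pps ups.
move: pps ups => /= /andP[pp psp] /andP[pps ups].
rewrite Gauss_dvd ?(psN p) ?mem_head//=; first by apply: IH => // q qps; rewrite psN// inE qps orbT.
rewrite coprime_sym /prodn; elim: (ps) cop => [|q qs IHq] cop; first by rewrite big_nil coprime1n.
rewrite big_cons coprimeMl cop ?mem_head//= IHq// => r rqs.
by rewrite cop// inE rqs orbT.
Qed.

Definition primes_upto n := [seq p <- index_iota 0 n.+1 | prime p].

Lemma mem_primes_upto n p : (p \in primes_upto n) = prime p && (p <= n)%N.
Proof. by rewrite mem_filter mem_index_iota leq0n ltnS. Qed.

Lemma primes_upto_uniq n : uniq (primes_upto n).
Proof. exact/filter_uniq/iota_uniq. Qed.

Lemma primes_upto_prime n : all prime (primes_upto n).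
Proof. exact: filter_all. Qed.

Lemma size_primes_upto n : (size (primes_upto n) <= n)%N.
Proof. by rewrite /primes_upto /index_iota subn0/= (leq_trans (size_subseq (filter_subseq _ _)))// size_iota. Qed.

(** The two middle coefficients are equal and both occur in the expansion of (1 + 1)^(2n+1). *)
Lemma bin_central n : ('C(n.*2.+1, n) <= 4 ^ n)%N.
Proof.
have S : (2 * 4 ^ n = \sum_(i < n.*2.+2) 'C(n.*2.+1, i))%N.
  rewrite -[4%N]/(2 ^ 2)%N -expnM -expnS mul2n -[2%N]/(1 + 1)%N expnDn.
  by apply: eq_bigr => i _; rewrite !exp1n !muln1.
have n1 : (n < n.*2.+2)%N by lia.
have n2 : (n.+1 < n.*2.+2)%N by lia.
have : (2 * 'C(n.*2.+1, n) <= 2 * 4 ^ n)%N; last by lia.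
rewrite S (bigD1 (Ordinal n1))//= (bigD1 (Ordinal n2))//=; last first.
  by rewrite -val_eqE /=; lia.
have -> : 'C(n.*2.+1, n.+1) = 'C(n.*2.+1, n).
  by rewrite -bin_sub; [congr 'C(_, _); lia|lia].
by rewrite addnA addnn -(mul2n 'C(_, _)) leq_addr.
Qed.



(** Erdos' argument: for n = 2m + 1 the primes in (m + 1, n] divide the binomial coefficient C(n,
    m), which is at most 4^m, and the primes up to m + 1 are covered by induction. *)
Lemma primorial_le n : (prodn (primes_upto n) <= 4 ^ n)%N.
Proof.
elim/ltn_ind: n => n IH.
have skip m : (m < n)%N -> (forall p, prime p -> (m < p <= n)%N -> false) ->
  (prodn (primes_upto n) <= 4 ^ n)%N.
  move=> mn H; have -> : primes_upto n = primes_upto m.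
    rewrite /primes_upto /index_iota !subn0 (_ : n.+1 = m.+1 + (n - m))%N; last lia.
    rewrite iotaD filter_cat -[RHS]cats0; congr (_ ++ _).
    apply/eqP; rewrite -(negbK (_ == _)) -has_filter; apply/hasPn => p.
    rewrite mem_iota add0n => pmn; apply/negP => pp.
    by apply: notF (H p pp _); lia.
  by rewrite (leq_trans (IH _ mn))// leq_exp2l// ltnW.
have [n1|n1] := leqP n 1.
  have [n0|n0] := posnP n.
    by rewrite n0 (_ : primes_upto 0 = [::])// /prodn big_nil.
  by apply: (skip 0%N n0) => p /prime_gt1; lia.
have [->|n2] := eqVneq n 2%N.
  by rewrite (_ : primes_upto 2 = [:: 2%N])// /prodn big_seq1.
(* An even n > 2 is not prime, so nothing changes from n - 1 to n. *)
have [on|en] := boolP (odd n); last first.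
  apply: (skip n.-1) => [|p pp pn]; first by lia.
  have pE : p = n by lia.
  by case: (even_prime pp) => [p2|op]; [lia|rewrite -pE op in en].
set m := n./2; have nE : n = m.*2.+1 by rewrite /m; lia.
have m1 : (1 <= m)%N by rewrite /m; lia.
pose qs := [seq p <- iota m.+2 m | prime p].
have -> : primes_upto n = primes_upto m.+1 ++ qs.
  by rewrite nE /primes_upto /index_iota !subn0 (_ : m.*2.+2 = m.+2 + m)%N ?iotaD ?filter_cat//; lia.
rewrite /prodn big_cat /= -/(prodn _) -/(prodn qs).
rewrite (_ : 4 ^ n = 4 ^ m.+1 * 4 ^ m)%N; last by rewrite -expnD; congr (_ ^ _)%N; lia.
apply: leq_mul; first by apply: IH; lia.
rewrite (leq_trans _ (bin_central m))// dvdn_leq// ?bin_gt0//; first by lia.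
apply: prodn_dvd; [exact: filter_all|exact/filter_uniq/iota_uniq|].
move=> p; rewrite mem_filter mem_iota => /andP[pp pm].
have : (p %| (m.*2.+1)`!)%N by rewrite dvdn_fact// prime_gt0//; lia.
rewrite -(@bin_fact m.*2.+1 m); last lia.
have nd k : (k < p)%N -> (p %| k`!)%N = false.
  elim: k => [|k IHk] kp; first by rewrite fact0 dvdn1; case: eqP pp => // ->.
  rewrite factS Euclid_dvdM// IHk ?orbF; last lia.
  by rewrite gtnNdvd.
by rewrite !Euclid_dvdM// !nd ?orbF//; lia.
Qed.

Lemma ln_prime_decomp (R : realType) N n : (0 < n)%N -> (n <= N)%N ->
  ln (n%:R : R) = \sum_(p <- primes_upto N) (logn p n)%:R * ln p%:R.
Proof.
move=> n0 nN; have E : n = (\prod_(0 <= p < N.+1) p ^ logn p n)%N.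
  by rewrite -[LHS](@partnT n)// (widen_partn _ nN); apply: eq_bigl.
have {1}-> : n = (\prod_(p <- primes_upto N) p ^ logn p n)%N.
  rewrite {1}E /primes_upto big_filter [RHS]big_mkcond /=; apply: eq_bigr => p _.
  by case: ifP => // /negbT np; rewrite lognE (negbTE np).
have : all prime (primes_upto N) by exact: primes_upto_prime.
elim: (primes_upto N) => [|p s IH] /=; first by rewrite !big_nil ln1.
move=> /andP[pp ps]; have p0 := prime_gt0 pp.
rewrite !big_cons natrM lnM ?posrE ?ltr0n ?expn_gt0 ?p0//; last first.
  rewrite big_seq; apply: prodn_cond_gt0 => q qs.
  by rewrite expn_gt0 prime_gt0//; exact: (allP ps).
by rewrite IH// natrX lnXn ?ltr0n// mulr_natl.
Qed.

Lemma ln_fact_legendre (R : realType) n :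
  ln (n`!%:R : R) = \sum_(p <- primes_upto n) (logn p n`!)%:R * ln p%:R.
Proof.
suff H m : (m <= n)%N -> ln (m`!%:R : R) = \sum_(p <- primes_upto n) (logn p m`!)%:R * ln p%:R.
  exact: H.
elim: m => [|m IH] mn.
  by rewrite fact0 ln1 big1// => p _; rewrite logn1 mul0r.
rewrite factS natrM lnM ?posrE ?ltr0n ?fact_gt0// IH ?(ltnW mn)//.
rewrite (@ln_prime_decomp R n)// -big_split /=; apply: eq_bigr => p _.
by rewrite -mulrDl -natrD -lognM ?fact_gt0.
Qed.

Lemma ln_nat_ge0 (R : realType) n : 0 <= ln (n%:R : R).
Proof. by case: n => [|n]; [rewrite ln0|rewrite ln_ge0// ler1n]. Qed.

Lemma le_ln_nat (R : realType) m n : (0 < m)%N -> (m <= n)%N -> ln (m%:R : R) <= ln n%:R.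
Proof. by move=> m0 mn; rewrite ler_ln ?posrE ?ltr0n ?ler_nat// (leq_trans m0). Qed.

(* 1 - 1/t <= ln t <= t - 1 at t = (n+1)/n. *)
Lemma ln_succ_bounds (R : realType) n : (0 < n)%N ->
  (ln (n.+1%:R : R) - ln n%:R <= n%:R^-1) * (n.+1%:R^-1 <= ln (n.+1%:R : R) - ln n%:R).
Proof.
move=> n0; have nr : 0 < (n%:R : R) by rewrite ltr0n.
have n1r : 0 < (n.+1%:R : R) by rewrite ltr0n.
rewrite -ln_div ?posrE//; split.
  rewrite (_ : n.+1%:R / n%:R = 1 + n%:R^-1 :> R); last first.
    by rewrite -natr1 mulrDl mul1r divff ?gt_eqF// addrC.
  by apply: le_ln1Dx; rewrite (@lt_trans _ _ 0)// ?invr_gt0// ltrN10.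
rewrite -lerN2 -lnV ?posrE ?divr_gt0// invf_div.
rewrite (_ : n%:R / n.+1%:R = 1 + - n.+1%:R^-1 :> R); last first.
  by rewrite -natr1; field; rewrite natr1 gt_eqF.
apply: le_ln1Dx; rewrite ltrN2 invf_lt1 ?ltr1n//; lia.
Qed.

Lemma ln_fact_le (R : realType) n : ln (n`!%:R : R) <= n%:R * ln n%:R.
Proof.
elim: n => [|n IH]; first by rewrite fact0 ln1 mul0r.
rewrite factS natrM lnM ?posrE ?ltr0n ?fact_gt0// -[X in _ <= X * _]natr1 mulrDl mul1r.
rewrite addrC lerD2r (le_trans IH)// ler_wpM2l//.
by case: n {IH} => [|n]; [rewrite ln0// ln1|exact: le_ln_nat].
Qed.

Lemma ln_fact_ge (R : realType) n : n%:R * ln n%:R - n%:R <= ln (n`!%:R : R).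
Proof.
elim: n => [|n IH]; first by rewrite fact0 ln1 mul0r subr0.
rewrite factS natrM lnM ?posrE ?ltr0n ?fact_gt0//.
case: n IH => [|n] IH; first by rewrite ln1; lra.
have [+ _] := ln_succ_bounds R (ltn0Sn n).
have nr : 0 < (n.+1%:R : R) by rewrite ltr0n.
have -> : n.+2%:R = n.+1%:R + 1 :> R by rewrite natr1.
rewrite -(ler_pM2l nr) mulfV ?gt_eqF//; lra.
Qed.

Lemma logn_fact_ge (R : realType) p n : prime p -> n%:R / p%:R - 1 <= ((logn p n`!)%:R : R).
Proof.
move=> pp; have p0 := prime_gt0 pp; have pr : 0 < (p%:R : R) by rewrite ltr0n.
apply: (@le_trans _ _ (n %/ p)%:R).
  rewrite lerBlDr ler_pdivrMr// mulrDl mul1r -natrM -natrD ler_nat.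
  by rewrite {1}(divn_eq n p) leq_add2l ltnW// ltn_pmod.
rewrite ler_nat logn_fact//; case: n => [|n]; first by rewrite div0n.
by rewrite big_nat_recl// expn1 leq_addr.
Qed.

Lemma logn_fact_le (R : realType) p n : prime p ->
  ((logn p n`!)%:R : R) <= n%:R / (p%:R - 1).
Proof.
move=> pp; have p1 := prime_gt1 pp; have pr : 0 < (p%:R - 1 : R) by rewrite subr_gt0 ltr1n.
have pr0 : 0 < (p%:R : R) by rewrite ltr0n prime_gt0.
rewrite logn_fact// natr_sum.
have G m : \sum_(1 <= k < m.+1) (p%:R ^- k : R) = (1 - p%:R ^- m) / (p%:R - 1).
  elim: m => [|m IH]; first by rewrite big_geq// expr0 invr1 subrr mul0r.
  rewrite big_nat_recr//= IH exprS; field.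
  by rewrite !gt_eqF ?exprn_gt0.
apply: (@le_trans _ _ (\sum_(1 <= k < n.+1) n%:R * p%:R ^- k)).
  apply: ler_sum => k _; rewrite ler_pdivlMr ?exprn_gt0// -natrX -natrM ler_nat.
  exact: leq_trunc_div.
by rewrite -mulr_sumr G mulrA ler_pM2r ?invr_gt0// ler_piMr// lerBlDr lerDl.
Qed.

Lemma sum_lnV_le (R : realType) n :
  \sum_(2 <= m < n.+1) ln (m%:R : R) / (m%:R * (m%:R - 1)) <= 2.
Proof.
(* A discrete primitive: it is 0 at n = 1, and passing from x to x + 1 only needs (ln(x + 1) - ln x)
   (x + 1) <= 2. *)
suff H : (0 < n)%N -> \sum_(2 <= m < n.+1) ln (m%:R : R) / (m%:R * (m%:R - 1)) <=
    2 - (ln n%:R + 2) / n%:R.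
  case: n H => [|n] H; first by rewrite big_geq.
  rewrite (le_trans (H _))// lerBlDr lerDl divr_ge0//.
  by rewrite addr_ge0// ln_nat_ge0.
elim: n => // n IH _; case: n IH => [|n] IH.
  by rewrite big_geq// ln1 add0r divr1 subrr.
rewrite big_nat_recr//= (le_trans (lerD (IH isT) (lexx _)))//.
have [+ _] := ln_succ_bounds R (ltn0Sn n).
have nr : 1 <= (n.+1%:R : R) by rewrite ler1n.
have -> : n.+2%:R = n.+1%:R + 1 :> R by rewrite natr1.
set x := n.+1%:R in nr *; set a := ln (x + 1); set b := ln x => ab.
rewrite (_ : x + 1 - 1 = x); last by ring.
have x0 : 0 < x by lra.
have x10 : 0 < x + 1 by lra.
rewrite -subr_ge0.
have -> : 2 - (a + 2) / (x + 1) - (2 - (b + 2) / x + a / ((x + 1) * x)) =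
   (b * (x + 1) + 2 - a * (x + 1)) / (x * (x + 1)).
  by field; rewrite !gt_eqF.
have : (a - b) * (x + 1) <= 2.
  apply: le_trans (ler_wpM2r (ltW x10) ab) _.
  by rewrite ler_pdivrMl//; lra.
by move=> ?; rewrite divr_ge0 ?mulr_ge0//; lra.
Qed.

Definition log_recip_sum (R : realType) n : R :=
  \sum_(p <- primes_upto n) ln p%:R / p%:R.

Lemma ler_sum_primes_upto (R : realType) n (f : nat -> R) :
  (forall m, (2 <= m)%N -> 0 <= f m) ->
  \sum_(p <- primes_upto n) f p <= \sum_(2 <= m < n.+1) f m.
Proof.
move=> f0; have -> : primes_upto n = [seq p <- index_iota 2 n.+1 | prime p].
  by case: n => [|n]//; rewrite /primes_upto /index_iota subn0 /= subSS subn1.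
rewrite big_filter big_mkcond big_nat_cond [leRHS]big_nat_cond.
by apply: ler_sum => m /andP[/andP[m2 _] _]; case: ifP => // _; exact: f0.
Qed.

(** Legendre's formula for ln n! is compared with n ln n - n <= ln n! <= n ln n. Replacing v_p(n!)
    by n/p costs at most 2n either way: for higher powers because 1/(p-1) - 1/p = 1/(p(p-1)), for
    rounding because the sum of ln p is at most n ln 4 <= 2n. The constant 3 adds the 1 of the lower
    bound for ln n!. *)
Lemma mertens_first (R : realType) n : (0 < n)%N ->
  `|log_recip_sum R n - ln n%:R| <= 3.
Proof.
move=> n0; have nr : 0 < (n%:R : R) by rewrite ltr0n.
have psp : {in primes_upto n, forall p, prime p} by apply/allP/primes_upto_prime.
have lo : ln (n`!%:R : R) <= n%:R * (log_recip_sum R n + 2).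
  have S : \sum_(p <- primes_upto n) ln (p%:R : R) / (p%:R * (p%:R - 1)) <= 2.
    apply: le_trans (sum_lnV_le R n); apply: ler_sum_primes_upto => m m2.
    by rewrite divr_ge0 ?ln_nat_ge0// mulr_ge0// subr_ge0 ler1n ltnW.
  apply: le_trans (ler_wpM2l (ltW nr) (lerD (lexx _) S)).
  rewrite ln_fact_legendre /log_recip_sum -big_split mulr_sumr /=.
  rewrite big_seq [leRHS]big_seq; apply: ler_sum => p /psp pp.
  have p1 : 1 < (p%:R : R) by rewrite ltr1n prime_gt1.
  apply: le_trans (ler_wpM2r (ln_nat_ge0 _ _) (logn_fact_le R n pp)) _.
  by rewrite le_eqVlt; apply/orP; left; apply/eqP; field; rewrite !gt_eqF//; lra.
have up : n%:R * log_recip_sum R n - n%:R * 2 <= ln (n`!%:R : R).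
  have T : \sum_(p <- primes_upto n) ln (p%:R : R) <= n%:R * 2.
    have -> : \sum_(p <- primes_upto n) ln (p%:R : R) = ln (prodn (primes_upto n))%:R.
      rewrite /prodn; have := primes_upto_prime n; elim: (primes_upto n) => [|p s IH].
        by rewrite !big_nil ln1.
      move=> /= /andP[pp ps]; rewrite !big_cons natrM lnM ?posrE ?IH// ltr0n; first exact: prime_gt0.
      exact: seqprod_gt0.
    rewrite -[leRHS]expRK expRM_natl.
    rewrite ler_ln ?posrE ?exprn_gt0 ?expR_gt0 ?ltr0n ?seqprod_gt0 ?primes_upto_prime//.
    apply: (@le_trans _ _ ((4 ^ n)%:R)); first by rewrite ler_nat primorial_le.
    rewrite natrX lerXn2r ?nnegrE ?expR_ge0//.
    have := expR_ge1Dx (1 : R); rewrite (_ : 2 = 1 + 1 :> R)// expRD; nra.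
  apply: (@le_trans _ _ (n%:R * log_recip_sum R n - \sum_(p <- primes_upto n) ln (p%:R : R))).
    by rewrite lerD2l lerN2.
  rewrite ln_fact_legendre /log_recip_sum mulr_sumr -sumrB.
  rewrite big_seq [leRHS]big_seq; apply: ler_sum => p /psp pp.
  apply: le_trans (ler_wpM2r (ln_nat_ge0 _ _) (logn_fact_ge R n pp)).
  by rewrite mulrBl mul1r mulrA mulrAC.
have f1 := ln_fact_le R n; have f2 := ln_fact_ge R n.
rewrite ler_norml; apply/andP; split; rewrite -(ler_pM2l nr); lra.
Qed.

Lemma primes_upto_sum_recr (R : realType) n (f : nat -> R) :
  \sum_(p <- primes_upto n.+1) f p =
  \sum_(p <- primes_upto n) f p + (if prime n.+1 then f n.+1 else 0).
Proof.
rewrite /primes_upto !big_filter [LHS]big_mkcond [X in _ = X + _]big_mkcond.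
by rewrite [LHS]big_nat_recr.
Qed.

(* Abel summation in differential form: with E(n) = sum_(p <= n) ln p / p - ln n,
   the increments of sum 1/p - ln ln n - E(n) / ln n are dominated by those of
   -1/ln n. *)
Lemma mertens_second (R : realType) : exists C : R, forall n, (2 <= n)%N ->
  `|recip_sum R (primes_upto n) - ln (ln n%:R)| <= C.
Proof.
pose E n : R := log_recip_sum R n - ln n%:R.
pose D n : R := recip_sum R (primes_upto n) - ln (ln n%:R) - E n / ln n%:R.
have lnpos n : (2 <= n)%N -> 0 < ln (n%:R : R).
  by move=> n2; rewrite ln_gt0// ltr1n.
have step n : (2 <= n)%N -> `|D n.+1 - D n| <= 4 * ((ln n%:R)^-1 - (ln n.+1%:R)^-1).
  move=> n2; have n0 : (0 < n)%N by lia.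
  have En := mertens_first R n0; rewrite -/(E n) in En.
  have [ab1 ab2] := ln_succ_bounds R n0.
  have a0 := lnpos _ n2; have b0 := lnpos _ (leqW n2).
  have ab : ln (n%:R : R) <= ln n.+1%:R by exact: le_ln_nat.
  (* If n + 1 is prime, it adds 1/(n + 1) both to the reciprocal sum and to E(n + 1) / ln(n + 1), so
     the increment is the same in both cases. *)
  have dE : D n.+1 - D n = E n * ((ln n%:R)^-1 - (ln n.+1%:R)^-1) +
      ((ln n.+1%:R - ln n%:R) / ln n.+1%:R - (ln (ln n.+1%:R) - ln (ln n%:R))).
    rewrite /D /E /recip_sum /log_recip_sum !primes_upto_sum_recr.
    case: ifP => _; last by field; rewrite !gt_eqF.
    by field; rewrite !gt_eqF// ltr0n.
  have ab3 : ln n.+1%:R - ln n%:R <= 1 :> R.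
    by rewrite (le_trans ab1)// invf_le1 ?ltr0n// ler1n.
  rewrite dE; set a := ln n%:R in a0 ab ab1 ab3 *; set b := ln n.+1%:R in b0 ab ab1 ab3 *.
  have l1 : ln b - ln a <= b / a - 1.
    rewrite -ln_div ?posrE// -[X in ln X](_ : 1 + (b / a - 1) = _); last by ring.
    by apply: le_ln1Dx; rewrite ltrBrDr addNr divr_gt0.
  have l2 : 1 - a / b <= ln b - ln a.
    rewrite -lerN2 !opprB -ln_div ?posrE// -[X in ln X](_ : 1 + (a / b - 1) = _); last by ring.
    by apply: le_ln1Dx; rewrite ltrBrDr addNr divr_gt0.
  have ia : 0 <= a^-1 - b^-1 by rewrite subr_ge0 lef_pV2.
  have x1 : (b - a) / b = 1 - a / b by field; rewrite gt_eqF.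
  have x2 : b / a - 1 - (1 - a / b) <= a^-1 - b^-1.
    have -> : b / a - 1 - (1 - a / b) = (b - a) * (a^-1 - b^-1) by field; rewrite !gt_eqF.
    by rewrite ler_piMl.
  rewrite (le_trans (ler_normD _ _))// (_ : 4 = 3 + 1); last by ring.
  rewrite (mulrDl 3 1) lerD//.
    by rewrite normrM (ger0_norm ia) ler_wpM2r.
  by rewrite x1 ler0_norm; lra.
exists (`|D 2%N| + 4 / ln 2 + 3 / ln 2) => n n2.
have tele : `|D n - D 2%N| <= 4 * ((ln 2)^-1 - (ln n%:R)^-1).
  elim: n n2 => // n IH; rewrite leq_eqVlt => /predU1P[<-|]; first by rewrite !subrr normr0 mulr0.
  rewrite ltnS => n2.
  have -> : D n.+1 - D 2%N = (D n.+1 - D n) + (D n - D 2%N) by ring.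
  by rewrite (le_trans (ler_normD _ _))//; have := step _ n2; have := IH n2; lra.
have En := mertens_first R (ltnW n2); rewrite -/(E n) in En.
have -> : recip_sum R (primes_upto n) - ln (ln n%:R) = (D n - D 2%N) + D 2%N + E n / ln n%:R.
  by rewrite /D; ring.
rewrite (le_trans (ler_normD _ _))// (le_trans (lerD (ler_normD _ _) (lexx _)))//.
have l2 : 0 < ln (2%:R : R) := lnpos 2%N isT.
have ln0 := lnpos _ n2.
have i1 : (ln n%:R)^-1 <= (ln 2)^-1 :> R by rewrite lef_pV2 ?posrE// le_ln_nat.
have i2 : 0 < (ln n%:R)^-1 :> R by rewrite invr_gt0.
have : `|E n / ln n%:R| <= 3 / ln 2.
  rewrite normrM (gtr0_norm i2); apply: ler_pM => //; exact: ltW.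
lra.
Qed.

(** * The Gaussian law *)

Definition gauss_density (R : realType) (x : R) : R :=
  (Num.sqrt (2 * pi))^-1 * expR (- x ^+ 2 / 2).

Definition gauss_mean (R : realType) (f : R -> R) : R :=
  \int[lebesgue_measure]_x (f x * gauss_density x).

Lemma gauss_densityE (R : realType) (x : R) : normal_pdf 0 1 x = gauss_density x.
Proof.
rewrite normal_pdfE ?oner_neq0// /gauss_density /normal_peak /normal_fun.
by rewrite !expr1n mul1r subr0 -(mulr_natl pi) !mulNr.
Qed.

Lemma gauss_density_ge0 (R : realType) (x : R) : 0 <= gauss_density x.
Proof. by rewrite -gauss_densityE normal_pdf_ge0. Qed.

Lemma continuous_gauss_density (R : realType) : continuous (@gauss_density R).
Proof.
rewrite (_ : @gauss_density R = normal_pdf 0 1).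
  by apply: continuous_normal_pdf; rewrite oner_neq0.
by apply/funext => x; rewrite gauss_densityE.
Qed.

Lemma gauss_peak_le1 (R : realType) : (Num.sqrt (2 * pi))^-1 <= 1 :> R.
Proof.
have pi2 := pi_ge2 R.
rewrite invf_le1 ?sqrtr_gt0; last by lra.
by rewrite -[leLHS](@sqrtr1 R) ler_sqrt; lra.
Qed.

Lemma gauss_density_le1 (R : realType) (x : R) : gauss_density x <= 1.
Proof.
rewrite /gauss_density mulr_ile1 ?invr_ge0 ?sqrtr_ge0 ?expR_ge0 ?gauss_peak_le1//.
by rewrite expR_le1 mulNr oppr_le0 divr_ge0// sqr_ge0.
Qed.

(** Up to a constant this is the normal density of variance 2. It dominates [gauss_density] times
    any function of linear growth. *)
Lemma integrable_expR_sqr4 (R : realType) :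
  lebesgue_measure.-integrable [set: R] (EFin \o (fun x => expR (- x ^+ 2 / 4))).
Proof.
have s0 : Num.sqrt 2 != 0 :> R by rewrite sqrtr_eq0 -ltNge.
have E (x : R) : expR (- x ^+ 2 / 4) = (normal_peak (Num.sqrt 2))^-1 * normal_pdf 0 (Num.sqrt 2) x.
  rewrite normal_pdfE// mulKf; last by rewrite gt_eqF// normal_peak_gt0.
  by rewrite /normal_fun subr0 sqr_sqrtr// -[2 *+ 2]mulr_natr -natrM.
rewrite (_ : _ \o _ = fun x => ((normal_peak (Num.sqrt 2))^-1)%:E * (normal_pdf 0 (Num.sqrt 2) x)%:E)%E.
  by apply: integrableZl => //; exact: integrable_normal_pdf.
by apply/funext => x /=; rewrite E EFinM.
Qed.

Lemma le_expR_sqr4 (R : realType) (x : R) :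
  (1 + `|x|) * gauss_density x <= 2 * expR (- x ^+ 2 / 4).
Proof.
apply: (@le_trans _ _ ((2 * expR (x ^+ 2 / 4)) * expR (- x ^+ 2 / 2))).
  apply: ler_pM; rewrite ?addr_ge0 ?gauss_density_ge0//.
    have := expR_ge1Dx (x ^+ 2 / 4).
    have : x ^+ 2 = `|x| ^+ 2 by rewrite real_normK// num_real.
    by move=> ->; nra.
  by rewrite /gauss_density ler_piMl ?expR_ge0 ?gauss_peak_le1.
by rewrite -mulrA -expRD ler_pM2l// ler_expR; lra.
Qed.

Lemma integrable_gauss (R : realType) (f : R -> R) (C : R) :
  measurable_fun setT f -> (forall x, `|f x| <= C * (1 + `|x|)) ->
  lebesgue_measure.-integrable [set: R] (EFin \o (fun x => f x * gauss_density x)).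
Proof.
move=> mf fC.
have C0 : 0 <= C by have := fC 0; rewrite normr0 addr0 mulr1; exact: le_trans.
have I := @integrableZl _ _ _ (@lebesgue_measure R) setT measurableT (2 * C) _ (integrable_expR_sqr4 R).
apply: (le_integrable measurableT _ _ I).
  apply/measurable_EFinP/measurable_funM => //.
  by apply: continuous_measurable_fun; exact: continuous_gauss_density.
move=> x _ /=; rewrite lee_fin normrM (ger0_norm (gauss_density_ge0 x)) [leRHS]ger0_norm; last first.
  by rewrite mulr_ge0 ?expR_ge0// mulr_ge0.
apply: le_trans (ler_wpM2r (gauss_density_ge0 x) (fC x)) _.
have := ler_wpM2l C0 (le_expR_sqr4 x); lra.
Qed.

Lemma integrable_gauss_cont (R : realType) (f : R -> R) (C : R) :
  continuous f -> (forall x, `|f x| <= C * (1 + `|x|)) ->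
  lebesgue_measure.-integrable [set: R] (EFin \o (fun x => f x * gauss_density x)).
Proof. by move=> cf; apply: integrable_gauss; exact: continuous_measurable_fun. Qed.

Lemma gauss_mean1 (R : realType) : gauss_mean (fun=> 1 : R) = 1.
Proof.
have := integral_normal_pdf (0 : R) 1.
rewrite /gauss_mean /Rintegral => E; rewrite [X in fine X](_ : _ = 1%E)//.
by rewrite -[RHS]E; apply: eq_integral => x _; rewrite mul1r gauss_densityE.
Qed.

Lemma integrable_gauss_density (R : realType) :
  lebesgue_measure.-integrable [set: R] (EFin \o @gauss_density R).
Proof.
rewrite (_ : EFin \o _ = EFin \o (fun x => 1 * gauss_density x)).
  by apply: (@integrable_gauss R (fun=> 1) 1) => // x; rewrite normr1 mul1r lerDl.
by apply/funext => x /=; rewrite mul1r.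
Qed.

Lemma PhiE (R : realType) (a : R) :
  Phi a = gauss_mean (fun x => (x <= a)%R%:R).
Proof.
have c0 : (Num.sqrt (2 * pi))^-1 != 0 :> R.
  by rewrite invr_eq0 sqrtr_eq0 -ltNge mulr_gt0// pi_gt0.
have I : lebesgue_measure.-integrable `]-oo, a] (EFin \o @gauss_density R).
  by apply: (integrableS measurableT) => //; exact: integrable_gauss_density.
rewrite /Phi /gauss_mean -RintegralZl//; last first.
  rewrite (_ : _ \o _ = fun x => ((Num.sqrt (2 * pi))%:E * (EFin \o @gauss_density R) x)%E).
    exact: integrableZl.
  apply/funext => x /=; rewrite -EFinM /gauss_density mulrA divff ?mul1r//.
  by rewrite -invr_eq0.
rewrite Rintegral_mkcond; apply: eq_Rintegral => x _.
rewrite patchE; case: ifPn => [|]; rewrite mem_setE in_itv /=.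
  by move=> ->; rewrite mul1r.
by move=> /negbTE ->; rewrite mul0r.
Qed.

Definition gauss_abs_mean (R : realType) : R := gauss_mean (fun x : R => `|x|).

Lemma gauss_abs_mean_ge0 (R : realType) : 0 <= gauss_abs_mean R.
Proof. by apply: Rintegral_ge0 => x _; rewrite mulr_ge0 ?gauss_density_ge0. Qed.

Lemma measurable_le_indic (R : realType) (b : R) :
  measurable_fun [set: R] (fun x => (x <= b)%R%:R : R).
Proof.
rewrite (_ : (fun x => _) = \1_`]-oo, b]); first exact: measurable_indic.
by apply/funext => x; rewrite indicE mem_setE in_itv /=.
Qed.

Lemma le_indic_norm (R : realType) (b x : R) : `|(x <= b)%R%:R : R| <= 1 * (1 + `|x|).
Proof. by rewrite mul1r; case: (x <= b); rewrite ?normr1 ?normr0 ?lerDl// addr_ge0. Qed.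

(** The term |x| / M exceeds 1 outside [-M, M], so an approximation that is controlled only on
    [-M, M] still compares in mean. [avg_le_tight] is the counterpart for averages. *)
Lemma gauss_mean_le (R : realType) (f g : R -> R) (C e M : R) :
  measurable_fun setT f -> measurable_fun setT g ->
  (forall x, `|f x| <= C * (1 + `|x|)) -> (forall x, `|g x| <= C * (1 + `|x|)) ->
  (forall x, f x <= g x + e + `|x| / M) ->
  gauss_mean f <= gauss_mean g + e + gauss_abs_mean R / M.
Proof.
move=> mf mg fC gC fg.
have If := integrable_gauss mf fC; have Ig := integrable_gauss mg gC.
have Ie : lebesgue_measure.-integrable [set: R] (EFin \o (fun x => e * gauss_density x)).
  apply: (@integrable_gauss R (fun=> e) `|e|) => // x.
  by rewrite ler_peMr// lerDl.
have Ia : lebesgue_measure.-integrable [set: R] (EFin \o (fun x => `|x| * gauss_density x)).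
  apply: (@integrable_gauss_cont R _ 1); first exact: norm_continuous.
  by move=> x; rewrite normr_id mul1r lerDr.
have IM : lebesgue_measure.-integrable [set: R] (EFin \o (fun x => (`|x| / M) * gauss_density x)).
  apply: (@integrable_gauss_cont R _ `|M^-1|).
    by move=> x; apply: cvgMl; exact: norm_continuous.
  by move=> x; rewrite normrM normr_id mulrC ler_wpM2l// lerDr.
have -> : e = \int[lebesgue_measure]_x (e * gauss_density x).
  rewrite RintegralZl//; last exact: integrable_gauss_density.
  rewrite -[LHS]mulr1 -(gauss_mean1 R); congr (_ * _).
  by apply: eq_Rintegral => x _; rewrite mul1r.
have -> : gauss_abs_mean R / M = \int[lebesgue_measure]_x ((`|x| / M) * gauss_density x).
  by rewrite mulrC -RintegralZl//; apply: eq_Rintegral => x _; ring.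
have Ige := @integrableD _ _ _ _ _ measurableT _ _ Ig Ie.
rewrite -RintegralD// -RintegralD//.
apply: le_Rintegral => //; first exact: (@integrableD _ _ _ _ _ measurableT _ _ Ige IM).
move=> x _; have := ler_wpM2r (gauss_density_ge0 x) (fg x); lra.
Qed.

(** The density is at most 1. This absorbs the small shifts of a in the sandwich arguments. *)
Lemma Phi_lipschitz (R : realType) (a b : R) : a <= b -> Phi b <= Phi a + (b - a).
Proof.
move=> ab; rewrite !PhiE.
have If (c : R) := integrable_gauss (measurable_le_indic c) (le_indic_norm c).
have mu_ab : lebesgue_measure `]a, b] = (b - a)%:E :> \bar R.
  rewrite lebesgue_measure_itv/= lte_fin; case: ltP => // ba.
  by rewrite (_ : b = a) ?subrr//; apply/eqP; rewrite eq_le ab ba.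
have Iab : lebesgue_measure.-integrable [set: R] (EFin \o (\1_`]a, b] : R -> R)).
  exact: integrable_indic_itv.
have -> : b - a = \int[lebesgue_measure]_x (\1_`]a, b] x).
  by transitivity (fine (b - a)%:E) => //; congr fine; rewrite integral_indic// setIT; exact: esym mu_ab.
rewrite -RintegralD//; apply: le_Rintegral => //.
  rewrite (_ : _ \o _ = (EFin \o (fun x : R => (x <= a)%R%:R * gauss_density x)%R) \+
    (EFin \o \1_`]a, b]))%E; last by apply/funext => x /=; rewrite EFinD.
  by apply: integrableD => //; exact: Iab.
move=> x _; have := gauss_density_ge0 x; have := gauss_density_le1 x.
rewrite indicE mem_setE in_itv /=; have [xa|xa] := leP x a.
  by rewrite (le_trans xa ab) addr0.
by case: (x <= b) => ? ?; rewrite ?mul1r ?mul0r ?add0r.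
Qed.

(** * Characteristic function of the Gaussian law *)

Lemma is_derive_gauss_density (R : realType) (x : R) :
  is_derive x 1 (@gauss_density R) (- x * gauss_density x).
Proof.
have d1 : is_derive x 1 (fun y : R => - 2^-1 * y ^+ 2) (- x).
  have := is_derive_monom (-1) x 1; rewrite expr1 mulN1r divr1.
  by rewrite (_ : (fun y => _) = fun y => - 2^-1 * y ^+ 2)//; apply/funext => y; rewrite (_ : 2`! = 2)%N//; field.
have := is_deriveZ (Num.sqrt (2 * pi))^-1 (@is_derive1_comp R expR _ x _ _ (is_derive_expR _) d1).
rewrite [X in is_derive _ _ X _](_ : _ = @gauss_density R); last first.
  by apply/funext => y; rewrite /gauss_density !fctE /= /GRing.scale/=; congr (_ * expR _); field.
rewrite [X in is_derive _ _ _ X](_ : _ = - x * gauss_density x)//.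
rewrite /gauss_density /GRing.scale/= [- 2^-1 * _](_ : _ = - x ^+ 2 / 2); last by field.
by ring.
Qed.

Lemma is_derive_trig_affine (R : realType) (t th z : R) :
  (is_derive z 1 (fun y => sin (t * y + th)) (t * cos (t * z + th))) *
  (is_derive z 1 (fun y => cos (t * y + th)) (- (t * sin (t * z + th)))).
Proof.
have d1 : is_derive z 1 (fun y : R => t * y + th) t.
  have := is_deriveD (is_deriveZ t (is_derive_id z (1 : R))) (is_derive_cst th z 1).
  rewrite addr0 [X in is_derive _ _ _ X](_ : _ = t)//.
  by rewrite /GRing.scale/= mulr1.
split.
  have := @is_derive1_comp R sin _ z _ _ (is_derive_sin _) d1.
  by rewrite mulrC.
have := @is_derive1_comp R cos _ z _ _ (is_derive_cos _) d1.
by rewrite mulNr mulrC.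
Qed.

Lemma continuous_trig_affine (R : realType) (t th : R) :
  continuous (fun y => sin (t * y + th)) /\ continuous (fun y => cos (t * y + th)).
Proof.
split=> z; apply: differentiable_continuous; apply/derivable1_diffP.
  by have [[]] := is_derive_trig_affine t th z.
by have [_ []] := is_derive_trig_affine t th z.
Qed.

Lemma cvg_Rintegral_segment (R : realType) (f : R -> R) :
  lebesgue_measure.-integrable [set: R] (EFin \o f) ->
  \int[lebesgue_measure]_(x in `[- n%:R, n%:R]) f x @[n --> \oo]
    --> \int[lebesgue_measure]_x f x.
Proof.
move=> If.
have mf : measurable_fun [set: R] (EFin \o f) by exact: measurable_int If.
pose f_ n := (EFin \o f) \_ `[- (n%:R : R), n%:R].
have := @dominated_convergence _ _ _ (@lebesgue_measure R) setT measurableT f_ (EFin \o f)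
  (fun x => `|(EFin \o f) x|%E) _ mf _ (integrable_abse If) _.
case=> [n|||_ _ c].
- by apply/(measurable_restrictT _ _).1 => //; exact: measurable_funTS.
- apply: aeW => x _; apply: cvg_near_cst; near=> n.
  rewrite /f_ patchE ifT// mem_setE in_itv/= -ler_norml.
  by near: n; exact: nbhs_infty_ger.
- apply: aeW => x n _; rewrite /f_ patchE; case: ifP => // _.
  by rewrite abse0 abse_ge0.
have E n : \int[lebesgue_measure]_(x in `[- n%:R, n%:R]) f x =
    fine (\int[lebesgue_measure]_x f_ n x)%E.
  by rewrite /Rintegral integral_mkcond.
rewrite (_ : (fun n => _) = fine \o (fun n => (\int[lebesgue_measure]_x f_ n x)%E)); last first.
  by apply/funext => n; rewrite E.
apply: fine_cvg; rewrite fineK//.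
exact: integrable_fin_num.
Unshelve. all: end_near. Qed.

Lemma cvg_gauss_density0 (R : realType) : gauss_density (n%:R : R) @[n --> \oo] --> 0.
Proof.
apply/cvgrPdist_lt => e e0; near=> n.
have n1 : 1 <= (n%:R : R) by near: n; exact: nbhs_infty_ger.
rewrite sub0r normrN ger0_norm ?gauss_density_ge0//.
have : e^-1 * 2 < (n%:R : R) by near: n; exact: nbhs_infty_gtr.
rewrite -(ltr_pM2l e0) mulrA mulfV ?gt_eqF// mul1r => en.
have l : gauss_density (n%:R : R) <= expR (- n%:R ^+ 2 / 2).
  by rewrite /gauss_density ler_piMl ?expR_ge0 ?gauss_peak_le1.
apply: (le_lt_trans l); set x := _ / 2.
have u := expR_ge1Dx (- x); have E := expRxMexpNx_1 x.
have x0 := expR_gt0 x.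
have xE : - x = n%:R ^+ 2 / 2 by rewrite /x; field.
have : n%:R / 2 * expR x <= 1.
  rewrite -[leRHS]E mulrC ler_pM2l// (le_trans _ u)// xE; nra.
nra.
Unshelve. all: end_near. Qed.

(** The integrand is the derivative of sin(t z + th) times the density, whose values at n and -n
    tend to 0. It yields the differential equation J' = - t J for the mean J(t) of cos(t z + th). *)
Lemma gauss_by_parts (R : realType) (t th : R) :
  gauss_mean (fun z => t * cos (t * z + th) - z * sin (t * z + th)) = 0.
Proof.
pose F z := sin (t * z + th) * gauss_density z.
pose f z := (t * cos (t * z + th) - z * sin (t * z + th)) * gauss_density z.
have [cs cc] := continuous_trig_affine t th.
have cf : continuous (fun z => t * cos (t * z + th) - z * sin (t * z + th)).
  by move=> z; apply: cvgB; apply: cvgM => //; [exact: cvg_cst|exact: cc|exact: cs].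
have If : lebesgue_measure.-integrable [set: R] (EFin \o f).
  apply: (@integrable_gauss_cont R _ (1 + `|t|) cf) => x.
  have := cos_max (t * x + th); have := sin_max (t * x + th) => s1 c1.
  rewrite (le_trans (ler_normB _ _))// !normrM.
  have := ler_wpM2l (normr_ge0 t) c1; have := ler_wpM2l (normr_ge0 x) s1.
  have := normr_ge0 t; have := normr_ge0 x; nra.
have dF (z : R) : is_derive z 1 F (f z).
  have [ds _] := is_derive_trig_affine t th z.
  have := is_deriveM ds (is_derive_gauss_density z).
  rewrite [X in is_derive _ _ _ X](_ : _ = f z)//.
  by rewrite /f /GRing.scale/=; ring.
have cF : continuous F.
  by move=> z; apply: differentiable_continuous; apply/derivable1_diffP; have [] := dF z.
have cff : continuous f by move=> z; apply: cvgM; [exact: cf|exact: continuous_gauss_density].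
have c1 := cvg_Rintegral_segment If.
have c0 : (\int[lebesgue_measure]_(x in `[- n%:R, n%:R]) f x) @[n --> \oo] --> (0 : R).
  apply/cvgr0Pnorm_le => e e0; near=> n.
  have n1 : 1 <= (n%:R : R) by near: n; exact: nbhs_infty_ger.
  have nn : - n%:R < n%:R :> R by lra.
  have := @continuous_FTC2 R f F _ _ nn (continuous_subspaceT cff).
  rewrite /Rintegral => ->; first last.
  - by move=> x _; rewrite derive1E; have [_ ->] := dF x.
  - split=> [x _||]; first by have [] := dF x.
      by apply: cvg_at_right_filter; exact: cF.
    by apply: cvg_at_left_filter; exact: cF.
  rewrite /= /F (_ : gauss_density (- n%:R) = gauss_density (n%:R : R)); last first.
    by rewrite /gauss_density sqrrN.
  rewrite -mulrBl normrM [X in _ * X]ger0_norm ?gauss_density_ge0//.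
  have : `|gauss_density (n%:R : R)| <= e / 2.
    near: n; apply: (cvgr0_norm_le _ (@cvg_gauss_density0 R)); exact: divr_gt0.
  rewrite (ger0_norm (gauss_density_ge0 (n%:R : R))) => g2.
  have : `|sin (t * n%:R + th) - sin (t * - n%:R + th)| <= 2.
    by rewrite (le_trans (ler_normB _ _))//; have := sin_max (t * n%:R + th);
      have := sin_max (t * - n%:R + th); lra.
  have := gauss_density_ge0 (n%:R : R); set u := gauss_density _ in g2 *; set v := `|_|.
  nra.
exact: cvg_unique c1 c0.
Unshelve. all: end_near. Qed.

Lemma gauss_mean_cos_derive (R : realType) (th t : R) :
  is_derive t 1 (fun t => gauss_mean (fun z => cos (t * z + th)))
    (- t * gauss_mean (fun z => cos (t * z + th))).
Proof.
pose f t z := cos (t * z + th) * gauss_density z.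
pose g (z : R) := (1 + `|z|) * gauss_density z.
have cos_le (s z : R) : `|cos (s * z + th)| <= 1 * (1 + `|z|).
  by rewrite mul1r (le_trans (cos_max _))// lerDl.
have Ic (s : R) : lebesgue_measure.-integrable [set: R] (EFin \o f s).
  by apply: (integrable_gauss_cont _ (cos_le s)); exact: (continuous_trig_affine s th).2.
have Ig : lebesgue_measure.-integrable [set: R] (EFin \o g).
  apply: (@integrable_gauss_cont R _ 1) => [z|z]; last by rewrite mul1r ger0_norm// addr_ge0.
  by apply: cvgD; [exact: cvg_cst|exact: norm_continuous].
have df (s z : R) : is_derive s 1 (f^~ z) (- (z * sin (s * z + th)) * gauss_density z).
  have [_ d] := is_derive_trig_affine z th s.
  have := is_deriveZ (gauss_density z) d.
  rewrite [X in is_derive _ _ X _](_ : _ = f^~ z); last first.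
    by apply/funext => y; rewrite /f (mulrC y) [RHS]mulrC.
  rewrite [X in is_derive _ _ _ X](_ : _ = - (z * sin (s * z + th)) * gauss_density z)//.
  by rewrite /GRing.scale/= (mulrC s z); ring.
have t1 : t - 1 < t < t + 1 by rewrite ltrDl ltrBlDr ltrDl ltr01.
have It : `]t - 1, t + 1[%classic t by rewrite /= in_itv.
have I0 (x : R) : `]t - 1, t + 1[%classic x -> lebesgue_measure.-integrable [set: R] (EFin \o f x).
  by move=> _; exact: Ic.
have D0 (x y : R) : `]t - 1, t + 1[%classic x -> [set: R] y -> derivable (f^~ y) x 1.
  by move=> _ _; have [] := df x y.
have g0 (y : R) : 0 <= g y by rewrite mulr_ge0 ?gauss_density_ge0// addr_ge0.
have P0 (x y : R) : `]t - 1, t + 1[%classic x -> [set: R] y -> `|partial1of2 f x y| <= g y.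
  move=> _ _; rewrite partial1of2E; have [_ ->] := df x y.
  rewrite normrM (ger0_norm (gauss_density_ge0 _)) ler_wpM2r ?gauss_density_ge0//.
  rewrite normrN normrM; have := sin_max (x * y + th); have := normr_ge0 y; nra.
have dd := derivable_under_integral measurableT It I0 D0 g0 Ig P0.
have dv := differentiation_under_integral measurableT It I0 D0 g0 Ig P0.
apply: DeriveDef; first exact: dd.
rewrite -derive1E [LHS]dv.
have := gauss_by_parts t th; rewrite /gauss_mean.
have Is : lebesgue_measure.-integrable [set: R] (EFin \o (fun z => (z * sin (t * z + th)) * gauss_density z)).
  apply: (@integrable_gauss_cont R _ 1) => [z|z].
    by apply: cvgM => //; exact: (continuous_trig_affine t th).1.
  rewrite mul1r normrM; have := sin_max (t * z + th); have := normr_ge0 z; nra.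
under eq_Rintegral do rewrite mulrBl -mulrA.
have Itc : lebesgue_measure.-integrable [set: R] (EFin \o (fun z => t * f t z)).
  by rewrite (_ : _ \o _ = fun z => (t%:E * (EFin \o f t) z)%E)//; exact: integrableZl.
rewrite (RintegralB _ Itc Is)// RintegralZl// => /eqP; rewrite subr_eq0 => /eqP E.
rewrite mulNr E -mulN1r -RintegralZl//; apply: eq_Rintegral => z _.
by rewrite partial1of2E; have [_ ->] := df t z; rewrite mulN1r mulNr.
Qed.

(** By J' = - t J, the product J(t) exp(t^2/2) has derivative 0, so it equals its value cos th at t
    = 0. *)
Lemma gauss_mean_cos (R : realType) (th t : R) :
  gauss_mean (fun z => cos (t * z + th)) = expR (- (t ^+ 2 / 2)) * cos th.
Proof.
pose J (t : R) := gauss_mean (fun z => cos (t * z + th)).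
have dE (s : R) : is_derive s 1 (fun s : R => expR (s ^+ 2 / 2)) (s * expR (s ^+ 2 / 2)).
  have d1 : is_derive s 1 (fun y : R => y ^+ 2 / 2) s.
    have := is_derive_monom 1 s 1; rewrite expr1 mul1r divr1.
    by under eq_fun do rewrite mul1r.
  by have := @is_derive1_comp R expR _ s _ _ (is_derive_expR _) d1; rewrite mulrC.
have H0 (s : R) : is_derive s 1 (fun s => J s * expR (s ^+ 2 / 2)) 0.
  have := is_deriveM (gauss_mean_cos_derive th s) (dE s).
  rewrite [X in is_derive _ _ _ X](_ : _ = 0)//.
  by rewrite /GRing.scale/=; ring.
have := is_derive_0_is_cst t 0 H0; rewrite expr0n/= mul0r expR0 mulr1.
have -> : J 0 = cos th.
  rewrite /J /gauss_mean; under eq_Rintegral do rewrite mul0r add0r.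
  rewrite RintegralZl//; last exact: integrable_gauss_density.
  rewrite -[RHS]mulr1 -(gauss_mean1 R); congr (_ * _).
  by apply: eq_Rintegral => x _; rewrite mul1r.
move=> <-; rewrite mulrC -mulrA -expRD subrr expR0 mulr1 //.
Qed.

(** * From trigonometric means to distribution functions *)

(** The phase makes sines and constants special cases of one generator. Product-to-sum formulas then
    make the class an algebra, so it contains polynomials in sin(x/M). *)
Inductive trig_poly (R : realType) : (R -> R) -> Prop :=
| trig_poly_cos c t th : trig_poly (fun x => c * cos (t * x + th))
| trig_poly_add f g : trig_poly f -> trig_poly g -> trig_poly (fun x => f x + g x).

Lemma trig_poly_ext (R : realType) (f g : R -> R) : f =1 g -> trig_poly f -> trig_poly g.
Proof. by move=> /funext ->. Qed.

Lemma trig_poly_cst (R : realType) (c : R) : trig_poly (fun=> c).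
Proof.
apply: (trig_poly_ext _ (trig_poly_cos c 0 0)) => x.
by rewrite mul0r addr0 cos0 mulr1.
Qed.

Lemma trig_poly_mul (R : realType) (f g : R -> R) :
  trig_poly f -> trig_poly g -> trig_poly (fun x => f x * g x).
Proof.
move=> tf; elim: tf g => [c t th|f1 f2 _ IH1 _ IH2] g tg; last first.
  by apply: (trig_poly_ext _ (trig_poly_add (IH1 _ tg) (IH2 _ tg))) => x; rewrite mulrDl.
elim: tg => [d s ph|g1 g2 _ IH1 _ IH2]; last first.
  by apply: (trig_poly_ext _ (trig_poly_add IH1 IH2)) => x; rewrite mulrDr.
apply: (trig_poly_ext _ (trig_poly_add
  (trig_poly_cos (c * d / 2) (t + s) (th + ph))
  (trig_poly_cos (c * d / 2) (t - s) (th - ph)))) => x.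
rewrite (_ : (t + s) * x + _ = (t * x + th) + (s * x + ph)); last by ring.
rewrite (_ : (t - s) * x + _ = (t * x + th) - (s * x + ph)); last by ring.
by rewrite cosD cosB; field.
Qed.

Lemma trig_poly_exp (R : realType) (f : R -> R) n :
  trig_poly f -> trig_poly (fun x => f x ^+ n).
Proof.
move=> tf; elim: n => [|n IH]; first exact: trig_poly_cst.
by apply: (trig_poly_ext _ (trig_poly_mul tf IH)) => x; rewrite exprS.
Qed.

Lemma trig_poly_props (R : realType) (f : R -> R) : trig_poly f ->
  continuous f /\ exists C, forall x, `|f x| <= C * (1 + `|x|).
Proof.
elim=> {f} [c t th|f g _ [cf [C fC]] _ [cg [D gD]]]; split.
- by move=> x; apply: cvgMr; exact: (continuous_trig_affine t th).2.
- exists `|c| => x; rewrite normrM ler_wpM2l// (le_trans (cos_max _))// lerDl//.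
- by move=> x; apply: cvgD; [exact: cf|exact: cg].
- exists (C + D) => x; rewrite (le_trans (ler_normD _ _))// mulrDl.
  exact: lerD.
Qed.

Lemma gauss_meanD (R : realType) (f g : R -> R) : trig_poly f -> trig_poly g ->
  gauss_mean (fun x => f x + g x) = gauss_mean f + gauss_mean g.
Proof.
move=> /trig_poly_props[cf [C fC]] /trig_poly_props[cg [D gD]].
rewrite /gauss_mean -RintegralD//; first by apply: eq_Rintegral => x _; rewrite mulrDl.
  exact: integrable_gauss_cont fC.
exact: integrable_gauss_cont gD.
Qed.

Lemma bernoulli_ineq (R : realType) (y : R) k : 0 <= y <= 1 -> 1 - k%:R * y <= (1 - y) ^+ k.
Proof.
move=> /andP[y0 y1]; elim: k => [|k IH]; first by rewrite mul0r subr0.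
rewrite exprS; have := @ler_wpM2l R (1 - y) _ _ _ IH; rewrite subr_ge0 => /(_ y1).
apply: le_trans; rewrite -natr1; have : 0 <= (k%:R : R) by []; nra.
Qed.

Lemma exp_lower (R : realType) (r : R) n : 1 <= r -> 1 + n%:R * (r - 1) <= r ^+ n.
Proof.
move=> r1; elim: n => [|n IH]; first by rewrite mul0r addr0.
rewrite exprS; have := ler_wpM2l (le_trans ler01 r1) IH.
apply: le_trans; rewrite -natr1; have := mulr_ge0 (ler0n R n) (sqr_ge0 (r - 1)); nra.
Qed.

(* For u in [0, 1] and k about th^-n, the polynomial (1 - u^n)^k is close to 1
   below th and close to 0 above it. *)
Lemma unit_step_poly (R : realType) (v1 th v2 e : R) :
  0 <= v1 -> v1 < th -> th < v2 -> th < 1 -> 0 < e ->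
  exists n k, forall u : R, 0 <= u <= 1 ->
    (u <= v1 -> 1 - e <= (1 - u ^+ n) ^+ k) /\ (v2 <= u -> (1 - u ^+ n) ^+ k <= e).
Proof.
move=> v10 v1t tv2 t1 e0.
have th0 : 0 < th by exact: le_lt_trans v10 v1t.
have r1 : 1 < v2 / th by rewrite ltr_pdivlMr// mul1r.
(* With th^-n <= k <= th^-n + 1: for u <= v1 one has k u^n <= (v1/th)^n + th^n <= e, and Bernoulli's
   inequality applies; for u >= v2 one has k u^n >= (v2/th)^n >= 1/e, and (1 - u^n)^k <= exp(- k
   u^n) <= e. *)
have [n [n1 n2 n3]] : exists n, [/\ (v1 / th) ^+ n <= e / 2, th ^+ n <= e / 2 & e^-1 <= (v2 / th) ^+ n].
  have c1 : (fun n => (v1 / th) ^+ n) @ \oo --> 0.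
    by apply: cvg_expr; rewrite ger0_norm ?divr_ge0 ?(ltW th0)// ltr_pdivrMr// mul1r.
  have c2 : (fun n => th ^+ n) @ \oo --> 0 by apply: cvg_expr; rewrite gtr0_norm.
  near \oo => n; exists n; split.
  - rewrite (le_trans (ler_norm _))//; near: n.
    by apply: (cvgr0_norm_le _ c1); rewrite divr_gt0.
  - rewrite (le_trans (ler_norm _))//; near: n.
    by apply: (cvgr0_norm_le _ c2); rewrite divr_gt0.
  - apply: le_trans (exp_lower n (ltW r1)).
    rewrite (@le_trans _ _ (n%:R * (v2 / th - 1)))// ?lerDr//.
    rewrite -ler_pdivrMr ?subr_gt0//; near: n; exact: nbhs_infty_ger.
pose x := th ^- n; have x0 : 0 < x by rewrite invr_gt0 exprn_gt0.
pose k := (Num.truncn x).+1.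
have kx : x <= k%:R by rewrite ltW// truncnS_gt.
have kx1 : k%:R <= x + 1 by rewrite -natr1 lerD2r truncn_le// ltW.
exists n, k => u /andP[u0 u1].
have un01 : 0 <= u ^+ n <= 1 by rewrite exprn_ge0//= exprn_ile1.
split=> uv.
  apply: le_trans (bernoulli_ineq k un01).
  have : u ^+ n <= v1 ^+ n by rewrite lerXn2r ?nnegrE.
  have : (v1 / th) ^+ n = v1 ^+ n * x by rewrite exprMn exprVn.
  have : v1 ^+ n <= th ^+ n by rewrite lerXn2r ?nnegrE// ltW.
  move: un01 => /andP[un0 un1].
  have := ler_wpM2l (ltW x0) (_ : u ^+ n <= v1 ^+ n).
  have : k%:R * u ^+ n <= (x + 1) * u ^+ n by rewrite ler_wpM2r.
  move=> a1 a2 a3 a4 a5; have := a2 a5; lra.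
have E : 1 - u ^+ n <= expR (- u ^+ n) by have := expR_ge1Dx (- u ^+ n); lra.
apply: (@le_trans _ _ (expR (- u ^+ n) ^+ k)).
  by rewrite lerXn2r ?nnegrE ?expR_ge0 ?subr_ge0//; case/andP: un01.
rewrite -expRM_natl.
have ux : (v2 / th) ^+ n <= k%:R * u ^+ n.
  rewrite exprMn exprVn mulrC; apply: ler_pM => //; rewrite ?exprn_ge0 ?(ltW x0)//.
    exact: ltW (lt_trans th0 tv2).
  by rewrite lerXn2r ?nnegrE// (le_trans (ltW th0)) ?ltW.
rewrite mulrN expRN -[leRHS]invrK lef_pV2 ?posrE ?expR_gt0 ?invr_gt0//.
rewrite (le_trans n3)// (le_trans ux)//.
by have := expR_ge1Dx (k%:R * u ^+ n); lra.
Unshelve. all: end_near. Qed.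

Lemma ltr_sin1 (R : realType) (x y : R) : -1 <= x -> x < y -> y <= 1 -> sin x < sin y.
Proof.
move=> x1 xy y1; have p1 := pihalf_ge1 R.
by rewrite ltr_sin// in_itv/=; apply/andP; split; lra.
Qed.

Lemma ler_sin (R : realType) (x y : R) : -1 <= x -> x <= y -> y <= 1 -> sin x <= sin y.
Proof.
rewrite (le_eqVlt x) => x1 /predU1P[->//|xy] y1.
by rewrite ltW// ltr_sin1.
Qed.

Lemma trig_step (R : realType) (a d e M : R) : 0 < d -> 0 < e -> `|a| + d <= M ->
  exists2 f, trig_poly f & forall x,
    [/\ 0 <= f x <= 1, - M <= x <= a - d -> 1 - e <= f x & a + d <= x <= M -> f x <= e].
Proof.
move=> d0 e0 aM; have M0 : 0 < M by rewrite (lt_le_trans _ aM)// ltr_wpDl.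
move: aM; rewrite -lerBrDr ler_norml => /andP[aM1 aM2].
(* On [-M, M] the argument stays in [-1, 1], where sine is increasing, so a step in u at the
   threshold u(a) is a step in x at a. Beyond M only 0 <= u <= 1 remains. *)
pose u x := (1 + sin (x / M)) / 2.
have u01 x : 0 <= u x <= 1.
  have := sin_geN1 (x / M); have := sin_le1 (x / M); rewrite /u => ? ?.
  by apply/andP; split; lra.
have le1 x : - M <= x -> -1 <= x / M by rewrite ler_pdivlMr// mulN1r.
have le2 x : x <= M -> x / M <= 1 by rewrite ler_pdivrMr// mul1r.
have umono x y : - M <= x -> x <= y -> y <= M -> u x <= u y.
  move=> Mx xy yM; rewrite /u ler_pM2r// lerD2l.
  by apply: ler_sin; rewrite ?le1 ?le2// ler_pM2r ?invr_gt0.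
have usmono x y : - M <= x -> x < y -> y <= M -> u x < u y.
  move=> Mx xy yM; rewrite /u ltr_pM2r// ltrD2l.
  by apply: ltr_sin1; rewrite ?le1 ?le2// ltr_pM2r ?invr_gt0.
have ua : u (a - d) < u a by apply: usmono; lra.
have ub : u a < u (a + d) by apply: usmono; lra.
have [n [k H]] := unit_step_poly (proj1 (andP (u01 (a - d)))) ua ub
   (lt_le_trans ub (proj2 (andP (u01 _)))) e0.
have tu : trig_poly u.
  apply: (trig_poly_ext _ (trig_poly_add (trig_poly_cst 2^-1) (trig_poly_cos 2^-1 M^-1 (- (pi / 2))))) => x.
  by rewrite cosBpihalf (mulrC M^-1) /u; field.
exists (fun x => (1 - u x ^+ n) ^+ k).
  apply: trig_poly_exp; apply: (trig_poly_ext _ (trig_poly_add (trig_poly_cst 1)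
    (trig_poly_mul (trig_poly_cst (-1)) (trig_poly_exp n tu)))) => x.
  by rewrite mulN1r.
move=> x; have [H1 H2] := H _ (u01 x); have /andP[ux0 ux1] := u01 x.
have v0 : 0 <= 1 - u x ^+ n by rewrite subr_ge0 exprn_ile1.
split.
- rewrite exprn_ge0//= exprn_ile1// lerBlDr lerDl exprn_ge0//.
- by move=> /andP[x1 x2]; apply: H1; apply: umono => //; lra.
- by move=> /andP[x1 x2]; apply: H2; apply: umono => //; lra.
Qed.

Lemma avg_trig_cvg (R : realType) (Z : nat -> nat -> R) :
  (forall t th : R, avg Y (fun l => cos (t * Z Y l + th)) @[Y --> \oo]
    --> expR (- (t ^+ 2 / 2)) * cos th) ->
  forall f, trig_poly f -> avg Y (fun l => f (Z Y l)) @[Y --> \oo] --> gauss_mean f.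
Proof.
move=> cos_cvg f; elim=> {f} [c t th|f g tf IHf tg IHg].
  rewrite (_ : gauss_mean _ = c * (expR (- (t ^+ 2 / 2)) * cos th)); last first.
    rewrite -gauss_mean_cos /gauss_mean -RintegralZl//.
      by apply: eq_Rintegral => x _; rewrite mulrA.
    apply: (@integrable_gauss_cont R _ 1); first exact: (continuous_trig_affine t th).2.
    by move=> x; rewrite mul1r (le_trans (cos_max _))// lerDl.
  under eq_fun do rewrite avgZ.
  by apply: cvgM; [exact: cvg_cst|exact: cos_cvg].
rewrite gauss_meanD//; under eq_fun do rewrite avgD.
exact: cvgD.
Qed.

Lemma avg_le_tight (R : realType) (z : nat -> R) (f g : R -> R) (C e M : R) Y :
  0 < M -> (0 < Y)%N ->
  (forall x, f x <= g x + e + `|x| / M) -> avg Y (fun l => `|z l|) <= C ->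
  avg Y (fun l => f (z l)) <= avg Y (fun l => g (z l)) + e + C / M.
Proof.
move=> M0 Y0 fg zC.
apply: (@le_trans _ _ (avg Y (fun l => (g (z l) + e) + M^-1 * `|z l|))).
  by apply: le_avg => l _; rewrite (mulrC M^-1).
rewrite avgD avgD avg_cst// avgZ lerD2l mulrC ler_wpM2r ?invr_ge0//.
exact: ltW.
Qed.

Lemma cdf_cvg (R : realType) (Z : nat -> nat -> R) (C : R) :
  (forall t th : R, avg Y (fun l => cos (t * Z Y l + th)) @[Y --> \oo]
    --> expR (- (t ^+ 2 / 2)) * cos th) ->
  (\forall Y \near \oo, avg Y (fun l => `|Z Y l|) <= C) ->
  forall a, avg Y (fun l => (Z Y l <= a)%R%:R : R) @[Y --> \oo] --> Phi a.
Proof.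
move=> cos_cvg tight a; apply/cvgrPdist_le => e0 e00; pose e := e0 / 8.
have e_gt0 : 0 < e by rewrite divr_gt0.
pose K := gauss_abs_mean R; have K0 : 0 <= K := gauss_abs_mean_ge0 R.
(* The last summand gives C/M <= e and K/M <= e; the others keep the transition intervals of both
   steps inside [-M, M]. *)
pose M := `|a| + e + e + (`|C| + K) / e.
have CK0 : 0 <= (`|C| + K) / e by rewrite divr_ge0 ?addr_ge0// ltW.
have M0 : 0 < M by have := normr_ge0 a; rewrite /M; lra.
have Me : (`|C| + K) / M <= e.
  rewrite ler_pdivrMr// mulrC -ler_pdivrMr//.
  by have := normr_ge0 a; rewrite /M; lra.
have CM : C / M <= e.
  by rewrite (le_trans _ Me)// ler_wpM2r ?invr_ge0 ?(ltW M0)// (le_trans (ler_norm _))// lerDl.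
have KM : K / M <= e.
  by rewrite (le_trans _ Me)// ler_wpM2r ?invr_ge0 ?(ltW M0)// lerDr.
have M1 : `|a + e| + e <= M by rewrite /M (le_trans (lerD (ler_normD _ _) (lexx _)))// (gtr0_norm e_gt0); lra.
have M2 : `|a - e| + e <= M by rewrite /M (le_trans (lerD (ler_normB _ _) (lexx _)))// (gtr0_norm e_gt0); lra.
have big (x : R) : M < `|x| -> 1 <= `|x| / M by move=> ?; rewrite ler_pdivlMr// mul1r ltW.
have xM0 (x : R) : 0 <= `|x| / M by rewrite divr_ge0// ltW.
(* The step f is centered at a + e and lies above the indicator of x <= a; the step g, centered at a
   - e, lies below it, both up to e + |x|/M. *)
have [f tf fP] := trig_step e_gt0 e_gt0 M1.
have [g tg gP] := trig_step e_gt0 e_gt0 M2.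
have below (h : R -> R) b : (forall x, [/\ 0 <= h x <= 1, - M <= x <= b - e -> 1 - e <= h x
    & b + e <= x <= M -> h x <= e]) ->
    (forall x, (x <= b - e)%R%:R <= h x + e + `|x| / M) /\
    (forall x, h x <= (x <= b + e)%R%:R + e + `|x| / M).
  move=> hP; split=> x; have [/andP[h0 h1] h2 h3] := hP x; have := xM0 x.
    have [xb|xb] := leP x (b - e); last by rewrite /=; lra.
    have [xM|xM] := leP (- M) x; first by have := h2 (introT andP (conj xM xb)); rewrite /=; lra.
    have bx : M < `|x| by rewrite ltr_normr; apply/orP; right; lra.
    by have := big _ bx; rewrite /=; lra.
  have [xb|xb] := leP x (b + e); first by rewrite /=; lra.
  have [xM|xM] := leP x M; first by have := h3 (introT andP (conj (ltW xb) xM)); rewrite /=; lra.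
  have bx : M < `|x| by rewrite ltr_normr; apply/orP; left.
  by have := big _ bx; rewrite /=; lra.
have [f1 f2] := below _ _ fP; have [g1 g2] := below _ _ gP.
have [cf [Cf fC]] := trig_poly_props tf; have [cg [Cg gC]] := trig_poly_props tg.
have mf := continuous_measurable_fun cf; have mg := continuous_measurable_fun cg.
have fb (h : R -> R) x : (forall x, 0 <= h x <= 1) -> `|h x| <= 1 * (1 + `|x|).
  move=> /(_ x)/andP[h0 h1]; rewrite ger0_norm// mul1r (le_trans h1)// lerDl//.
have Gf : gauss_mean f <= Phi (a + e + e) + e + K / M.
  rewrite PhiE; apply: gauss_mean_le mf (measurable_le_indic _) _ (@le_indic_norm R _) f2.
  by move=> x; apply: fb => // y; have [] := fP y.
have Gg : Phi (a - e - e) <= gauss_mean g + e + K / M.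
  rewrite PhiE; apply: gauss_mean_le (measurable_le_indic _) mg (@le_indic_norm R _) _ g1.
  by move=> x; apply: fb => // y; have [] := gP y.
have L1 : Phi (a + e + e) <= Phi a + (a + e + e - a) by apply: Phi_lipschitz; lra.
have L2 : Phi a <= Phi (a - e - e) + (a - (a - e - e)) by apply: Phi_lipschitz; lra.
have cvf := avg_trig_cvg cos_cvg tf; have cvg := avg_trig_cvg cos_cvg tg.
near=> Y.
have Y0 : (0 < Y)%N by near: Y; exact: nbhs_infty_gt.
have tY : avg Y (fun l => `|Z Y l|) <= C by near: Y.
have fY : `|gauss_mean f - avg Y (fun l => f (Z Y l))| <= e.
  by near: Y; exact: (cvgr_dist_le _ _ cvf).
have gY : `|gauss_mean g - avg Y (fun l => g (Z Y l))| <= e.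
  by near: Y; exact: (cvgr_dist_le _ _ cvg).
have f3 (x : R) : (x <= a)%R%:R <= f x + e + `|x| / M.
  by have := f1 x; rewrite addrK.
have g3 (x : R) : g x <= (x <= a)%R%:R + e + `|x| / M.
  by have := g2 x; rewrite subrK.
have U := avg_le_tight M0 Y0 f3 tY; have L := avg_le_tight M0 Y0 g3 tY.
move: fY gY U L; rewrite !ler_norml.
have e8 : e0 = 8 * e by rewrite /e; field.
move=> /andP[fY1 fY2] /andP[gY1 gY2] U L.
by apply/andP; split; lra.
Unshelve. all: end_near. Qed.

(** * The Erdos-Kac theorem for truncated sums *)

Definition lnln (R : realType) (Y : nat) : R := ln (ln Y%:R).

(* The truncation level is y = Y^(1/u) with u = (ln ln Y)^(1/4): then every fixed
   power of y is o(Y), an integer l <= Y has at most u prime factors above y, and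
   ln ln y = ln ln Y + O(u), where u = o(sqrt (ln ln Y)). *)
Definition trunc_exp (R : realType) (Y : nat) : R := Num.sqrt (Num.sqrt (lnln R Y)).

Definition trunc_level (R : realType) (Y : nat) : nat :=
  Num.truncn (expR (ln (Y%:R : R) / trunc_exp R Y)).

Lemma near_trunc_exp_ge (R : realType) (A : R) :
  \forall Y \near \oo, A <= trunc_exp R Y.
Proof.
pose B := Num.max A 0.
near=> Y.
have YB : expR (expR (B ^+ 4)) <= (Y%:R : R) by near: Y; exact: nbhs_infty_ger.
have B0 : 0 <= B by rewrite le_max lexx orbT.
have e1 := expR_gt0 (expR (B ^+ 4)); have e2 := expR_gt0 (B ^+ 4).
have l1 : expR (B ^+ 4) <= ln (Y%:R : R).
  by rewrite -[leLHS]expRK ler_ln ?posrE// (lt_le_trans e1).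
have l2 : B ^+ 4 <= lnln R Y.
  by rewrite -[leLHS]expRK ler_ln ?posrE// (lt_le_trans e2).
apply: (@le_trans _ _ B); first by rewrite le_max lexx.
have E : B = Num.sqrt (Num.sqrt (B ^+ 4)).
  rewrite -[4%N]/(2 * 2)%N exprM sqrtr_sqr (ger0_norm (sqr_ge0 _)) sqrtr_sqr.
  by rewrite ger0_norm.
have B40 : 0 <= B ^+ 4 by rewrite exprn_ge0.
by rewrite E /trunc_exp ler_sqrt ?sqrtr_ge0// ler_sqrt// (le_trans B40).
Unshelve. all: end_near. Qed.

(** Square roots of negative numbers and logarithms of nonpositive ones have the default value 0; a
    value of at least 1 rules these cases out. *)
Lemma trunc_exp_spec (R : realType) Y : 1 <= trunc_exp R Y ->
  [/\ lnln R Y = trunc_exp R Y ^+ 4, 1 < ln (Y%:R : R) & (1 < Y)%N].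
Proof.
rewrite /trunc_exp => u1.
have s1 : 0 < Num.sqrt (lnln R Y) by rewrite -sqrtr_gt0 (lt_le_trans ltr01).
have L0 : 0 < lnln R Y by rewrite -sqrtr_gt0.
have lY : 1 < ln (Y%:R : R).
  rewrite ltNge; apply: contraTN L0 => ?; rewrite -leNgt; exact: ln_le0.
have Y1 : 1 < (Y%:R : R).
  rewrite ltNge; apply: contraTN lY => ?; rewrite -leNgt (le_trans (ln_le0 _))//.
split => //; last by rewrite -(ltr1n R).
by rewrite -[4%N]/(2 * 2)%N exprM !sqr_sqrtr// ltW.
Qed.

Lemma trunc_level_bounds (R : realType) Y :
  ((trunc_level R Y)%:R <= expR (ln (Y%:R : R) / trunc_exp R Y)) /\
  (expR (ln (Y%:R : R) / trunc_exp R Y) < (trunc_level R Y).+1%:R).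
Proof. by rewrite /trunc_level truncn_le ?truncnS_gt// expR_ge0. Qed.

Lemma near_trunc_level_ge (R : realType) (A : nat) :
  \forall Y \near \oo, (A <= trunc_level R Y)%N.
Proof.
near=> Y.
have u1 : 1 <= trunc_exp R Y by near: Y; exact: near_trunc_exp_ge.
have uA : A%:R + 2 <= trunc_exp R Y by near: Y; exact: near_trunc_exp_ge.
have [LE lY Y1] := trunc_exp_spec u1; have [_ yl] := trunc_level_bounds R Y.
rewrite -ltnS -(ltr_nat R) (le_lt_trans _ yl)//.
have lYE : ln (Y%:R : R) = expR (trunc_exp R Y ^+ 4).
  by rewrite -LE /lnln lnK// posrE (lt_trans ltr01).
set u := trunc_exp R Y in u1 uA LE lYE *.
have A0 : 0 <= (A%:R : R) by [].
have e1 : u ^+ 2 <= expR (u ^+ 4).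
  have := expR_ge1Dx (u ^+ 4); rewrite (_ : u ^+ 4 = u ^+ 2 * u ^+ 2); last by ring.
  have : 1 <= u ^+ 2 by rewrite expr_ge1//; lra.
  nra.
have : u <= ln (Y%:R : R) / u by rewrite lYE ler_pdivlMr -?expr2//; lra.
have := expR_ge1Dx (ln (Y%:R : R) / u); lra.
Unshelve. all: end_near. Qed.

Definition prime_mean (R : realType) (Y : nat) : R := recip_sum R (primes_upto (trunc_level R Y)).

(** As y + 1 <= y^2, ln Y <= 2 u ln y, so truncation costs ln ln Y at most ln(2u). The crude bound
    2u suffices, u being the fourth root of ln ln Y. *)
Lemma near_prime_mean (R : realType) : exists C : R,
  \forall Y \near \oo, `|prime_mean R Y - lnln R Y| <= C + 2 * trunc_exp R Y.
Proof.
have [C HC] := mertens_second R; exists C.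
near=> Y.
have u1 : 1 <= trunc_exp R Y by near: Y; exact: near_trunc_exp_ge.
have y2 : (2 <= trunc_level R Y)%N by near: Y; exact: near_trunc_level_ge.
have [LE lY Y1] := trunc_exp_spec u1; have [yl yu] := trunc_level_bounds R Y.
have := HC _ y2; rewrite -/(prime_mean R Y).
set y := trunc_level R Y in y2 yl yu *; set u := trunc_exp R Y in u1 LE yl yu *.
have y0 : 0 < (y%:R : R) by rewrite ltr0n ltnW.
have ly0 : 0 < ln (y%:R : R) by rewrite ln_gt0// ltr1n.
have up : ln (ln (y%:R : R)) <= lnln R Y.
  rewrite /lnln ler_ln ?posrE//; last by rewrite (lt_trans ltr01).
  rewrite (@le_trans _ _ (ln (Y%:R : R) / u))//.
    by rewrite -[leRHS]expRK ler_ln ?posrE ?expR_gt0.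
  by rewrite ler_pdivrMr ?ler_peMr//; lra.
have lo : lnln R Y <= ln (ln (y%:R : R)) + 2 * u.
  have l1 : ln (Y%:R : R) <= 2 * u * ln y%:R.
    have : ln (Y%:R : R) / u <= 2 * ln y%:R.
      rewrite -[leLHS]expRK mulr_natl -lnXn// ler_ln ?posrE ?expR_gt0 ?exprn_gt0//.
      by rewrite (le_trans (ltW yu))// -natrX ler_nat -mulnn; nia.
    by rewrite ler_pdivrMr; lra.
  rewrite /lnln (@le_trans _ _ (ln (2 * u * ln y%:R)))//.
    by rewrite ler_ln ?posrE// ?mulr_gt0//; lra.
  rewrite lnM ?posrE// ?mulr_gt0//; [|lra].
  by rewrite addrC lerD2l ltW// ln_sublinear//; lra.
rewrite !ler_norml => /andP[? ?]; apply/andP; split; lra.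
Unshelve. all: end_near. Qed.

Lemma near_prime_mean_ge (R : realType) :
  \forall Y \near \oo, lnln R Y / 2 <= prime_mean R Y.
Proof.
have [C HC] := near_prime_mean R.
near=> Y.
have u1 : 1 <= trunc_exp R Y by near: Y; exact: near_trunc_exp_ge.
have uC : 2 * `|C| + 4 <= trunc_exp R Y by near: Y; exact: near_trunc_exp_ge.
have : `|prime_mean R Y - lnln R Y| <= C + 2 * trunc_exp R Y by near: Y.
have [LE _ _] := trunc_exp_spec u1; rewrite ler_norml LE => /andP[+ _].
set u := trunc_exp R Y in u1 uC *.
have C1 := ler_norm C; have C2 := normr_ge0 C.
have : u * u <= u ^+ 4.
  by rewrite -expr2 ler_weXn2l.
nra.
Unshelve. all: end_near. Qed.

Lemma near_prime_mean_ge_cst (R : realType) (A : R) :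
  \forall Y \near \oo, A <= prime_mean R Y.
Proof.
near=> Y.
have u1 : 1 <= trunc_exp R Y by near: Y; exact: near_trunc_exp_ge.
have uA : 2 * A <= trunc_exp R Y by near: Y; exact: near_trunc_exp_ge.
have m2 : lnln R Y / 2 <= prime_mean R Y by near: Y; exact: near_prime_mean_ge.
have [LE _ _] := trunc_exp_spec u1; rewrite LE in m2.
have : trunc_exp R Y <= trunc_exp R Y ^+ 4 by rewrite ler_eXnr.
lra.
Unshelve. all: end_near. Qed.

Lemma near_level_pow (R : realType) k (e : R) : 0 < e ->
  \forall Y \near \oo, (trunc_level R Y)%:R ^+ k / Y%:R <= e.
Proof.
move=> e0; near=> Y.
have u1 : 1 <= trunc_exp R Y by near: Y; exact: near_trunc_exp_ge.
have uk : k%:R + k%:R <= trunc_exp R Y by near: Y; exact: near_trunc_exp_ge.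
have lA : 2 / e <= ln (Y%:R : R).
  have ue : 2 / e <= trunc_exp R Y by near: Y; exact: near_trunc_exp_ge.
  have [LE lY Y1] := trunc_exp_spec u1.
  have -> : ln (Y%:R : R) = expR (trunc_exp R Y ^+ 4).
    by rewrite -LE /lnln lnK// posrE (lt_trans ltr01).
  have : trunc_exp R Y <= trunc_exp R Y ^+ 4 by rewrite ler_eXnr.
  have := expR_ge1Dx (trunc_exp R Y ^+ 4); lra.
have [LE lY Y1] := trunc_exp_spec u1; have [yl _] := trunc_level_bounds R Y.
have Y0 : 0 < (Y%:R : R) by rewrite ltr0n ltnW.
set u := trunc_exp R Y in u1 uk yl *; set l := ln (Y%:R : R) in lA lY yl *.
have YE : (Y%:R : R) = expR l by rewrite lnK.
(* For u >= 2k, y^k <= Y^(k/u) is at most the square root of Y. *)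
apply: (@le_trans _ _ (expR (l / 2) / Y%:R)).
  rewrite ler_pM2r ?invr_gt0// (@le_trans _ _ (expR (l / u) ^+ k))//.
    by rewrite lerXn2r ?nnegrE ?expR_ge0.
  rewrite -expRM_natl ler_expR mulrCA ler_pM2l; last lra.
  by rewrite ler_pdivrMr; lra.
rewrite YE -expRB (_ : l / 2 - l = - (l / 2)); last by field.
rewrite expRN -[leRHS]invrK lef_pV2 ?posrE ?expR_gt0 ?invr_gt0//.
have := expR_ge1Dx (l / 2); have : (2 / e) / 2 = e^-1 by field; rewrite gt_eqF.
lra.
Unshelve. all: end_near. Qed.

Lemma recip_sqr_sum_le (R : realType) y : recip_sqr_sum R (primes_upto y) <= 1.
Proof.
apply: (@le_trans _ _ (\sum_(2 <= m < y.+1) (m%:R^-1 ^+ 2 : R))).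
  by apply: ler_sum_primes_upto => m _; rewrite exprn_ge0// invr_ge0.
suff H : (0 < y)%N -> \sum_(2 <= m < y.+1) (m%:R^-1 ^+ 2 : R) <= 1 - y%:R^-1.
  case: y H => [|y] H; first by rewrite big_geq.
  by rewrite (le_trans (H _))// lerBlDr lerDl invr_ge0.
elim: y => // y IH _; case: y IH => [|y] IH; first by rewrite big_geq// invr1 subrr.
rewrite big_nat_recr//= (le_trans (lerD (IH isT) (lexx _)))//.
rewrite -(natr1 y.+1); set x := y.+1%:R; have x1 : 1 <= x by rewrite ler1n.
rewrite -subr_ge0 (_ : 1 - _ - _ = (x * (x + 1) ^+ 2)^-1).
  by rewrite invr_ge0 mulr_ge0 ?sqr_ge0//; lra.
by field; apply/andP; split; rewrite gt_eqF//; lra.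
Qed.

(** Scaled by the root of [prime_mean] rather than of ln ln Y, so that s = t / sqrt mu gives s^2 mu
    = t^2 exactly. The variance on a period is smaller than mu by the sum of 1/p^2, which is
    bounded. *)
Definition normalized (R : realType) (Y l : nat) : R :=
  centered R (primes_upto (trunc_level R Y)) l / Num.sqrt (prime_mean R Y).

Lemma near_size_pow (R : realType) k (A e : R) : 0 < e -> 0 <= A ->
  \forall Y \near \oo,
   A * (2 * size (primes_upto (trunc_level R Y)))%:R ^+ k / Y%:R <= e.
Proof.
move=> e0 A0; have c0 : 0 < A * 2 ^+ k + 1 by rewrite ltr_wpDl// mulr_ge0 ?exprn_ge0.
near=> Y.
have H : (trunc_level R Y)%:R ^+ k / Y%:R <= e / (A * 2 ^+ k + 1).
  by near: Y; apply: near_level_pow; rewrite divr_gt0.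
apply: (@le_trans _ _ (A * 2 ^+ k * ((trunc_level R Y)%:R ^+ k / Y%:R))).
  rewrite natrM exprMn !mulrA ler_wpM2r ?invr_ge0// ler_wpM2l ?mulr_ge0 ?exprn_ge0//.
  by rewrite lerXn2r ?nnegrE// ler_nat size_primes_upto.
apply: le_trans (ler_wpM2l _ H) _; first by rewrite mulr_ge0 ?exprn_ge0.
rewrite mulrCA ler_piMr// ?(ltW e0)// ler_pdivrMr// mul1r lerDl//.
Unshelve. all: end_near. Qed.

Lemma normalized_cos_cvg (R : realType) (t th : R) :
  avg Y (fun l => cos (t * normalized R Y l + th)) @[Y --> \oo]
    --> expR (- (t ^+ 2 / 2)) * cos th.
Proof.
apply/cvgrPdist_le => e e0.
(* The order k is fixed before Y, because the transfer error vanishes only for a fixed power of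
   y. *)
have [k Hk] : exists k, 4 * 4^-1 ^+ k * expR (8 * t ^+ 2) <= e / 4.
  have c1 : (fun n => (4^-1 : R) ^+ n) @ \oo --> 0.
    by apply: cvg_expr; rewrite gtr0_norm ?invr_gt0// invf_lt1// ltr1n.
  near \oo => k; exists k.
  have : `|4^-1 ^+ k| <= e / (16 * expR (8 * t ^+ 2)).
    by near: k; apply: (cvgr0_norm_le _ c1); rewrite divr_gt0 ?mulr_gt0 ?expR_gt0.
  rewrite ger0_norm ?exprn_ge0 ?invr_ge0// ler_pdivlMr ?mulr_gt0 ?expR_gt0//.
  lra.
near=> Y.
have u1 : 1 <= trunc_exp R Y by near: Y; exact: near_trunc_exp_ge.
have y2 : (2 <= trunc_level R Y)%N by near: Y; exact: near_trunc_level_ge.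
have [_ _ Y1] := trunc_exp_spec u1.
have m1 : 1 <= prime_mean R Y by near: Y; exact: near_prime_mean_ge_cst.
(* [m2] gives |s| <= 1/4; [m3] bounds the cubic error, equal to |t|^3 / sqrt mu; [m4] bounds the
   error in s^2. *)
have m2 : (4 * `|t|) ^+ 2 <= prime_mean R Y by near: Y; exact: near_prime_mean_ge_cst.
have m3 : (4 * `|t| ^+ 3 / e) ^+ 2 <= prime_mean R Y by near: Y; exact: near_prime_mean_ge_cst.
have m4 : 4 * t ^+ 2 / e <= prime_mean R Y by near: Y; exact: near_prime_mean_ge_cst.
have H1 : (k.*2.+1)%:R * (2 * size (primes_upto (trunc_level R Y)))%:R ^+ k.*2 / Y%:R <= e / 4.
  by near: Y; apply: near_size_pow; rewrite ?divr_gt0.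
pose mu := prime_mean R Y; rewrite -/mu in m1 m2 m3 m4.
pose r := Num.sqrt mu; have r2 : r ^+ 2 = mu by rewrite sqr_sqrtr//; lra.
have r0 : 0 < r by rewrite sqrtr_gt0; lra.
have ler_r x : 0 <= x -> x ^+ 2 <= mu -> x <= r.
  by move=> x0; rewrite -r2 ler_pXn2r ?nnegrE// ltW.
pose s := t / r.
have s4 : `|s| <= 4^-1.
  rewrite normrM normfV (gtr0_norm r0) ler_pdivrMr// ler_pdivlMl//.
  by apply: ler_r => //; rewrite mulr_ge0.
have n0 : (0 < size (primes_upto (trunc_level R Y)))%N.
  by case E : (primes_upto _) (mem_primes_upto (trunc_level R Y) 2) => //; rewrite y2.
have := avg_cos_approx th k (primes_upto_prime _) (primes_upto_uniq _) s4 (ltnW Y1) n0.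
have smu : s ^+ 2 * mu = t ^+ 2 by rewrite -r2 /s; field; rewrite gt_eqF.
rewrite -/(prime_mean R Y) -/mu -(mulrA 8) smu.
under eq_avg => l _.
  rewrite (_ : th + _ = t * normalized R Y l + th); last first.
    by rewrite /normalized -/mu -/r /s; ring.
  over.
rewrite distrC => H; apply: (le_trans H).
have H3 : `|s| ^+ 3 * mu <= e / 4.
  rewrite normrM normfV (gtr0_norm r0) exprMn exprVn -r2.
  rewrite (_ : _ * _ = `|t| ^+ 3 / r); last by field; rewrite gt_eqF.
  have m5 : 4 * `|t| ^+ 3 / e <= r.
    by apply: ler_r => //; rewrite divr_ge0 ?mulr_ge0 ?exprn_ge0// ltW.
  by rewrite ler_pdivrMr//; move: m5; rewrite ler_pdivrMr//; lra.
have H4 : s ^+ 2 * recip_sqr_sum R (primes_upto (trunc_level R Y)) <= e / 4.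
  apply: (@le_trans _ _ (s ^+ 2)).
    by rewrite ler_piMr ?sqr_ge0// recip_sqr_sum_le.
  rewrite /s exprMn exprVn r2 ler_pdivrMr; last lra.
  by move: m4; rewrite ler_pdivrMr//; lra.
move: H1 Hk; lra.
Unshelve. all: end_near. Qed.

(** By |x| <= 1 + x^2 the second moment suffices: with s^2 mu = 1 it is at most 4 e^2 plus a
    transfer error, eventually at most 1. *)
Lemma normalized_tight (R : realType) :
  \forall Y \near \oo, avg Y (fun l => `|normalized R Y l|) <= 4 * expR 2 + 2.
Proof.
near=> Y.
have u1 : 1 <= trunc_exp R Y by near: Y; exact: near_trunc_exp_ge.
have [_ _ Y1] := trunc_exp_spec u1.
have m4 : 4 <= prime_mean R Y by near: Y; exact: near_prime_mean_ge_cst.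
have H1 : 2 * (2 * size (primes_upto (trunc_level R Y)))%:R ^+ 2 / Y%:R <= 1 :> R.
  by near: Y; apply: near_size_pow.
pose mu := prime_mean R Y; rewrite -/mu in m4.
pose r := Num.sqrt mu; have r2 : r ^+ 2 = mu by rewrite sqr_sqrtr//; lra.
have r0 : 0 < r by rewrite sqrtr_gt0; lra.
have r2' : 2 <= r.
  by rewrite -(ler_pXn2r (n := 2)) ?nnegrE ?(ltW r0)// r2; lra.
have s1 : `|r^-1| <= 2^-1 by rewrite normfV (gtr0_norm r0) lef_pV2 ?posrE.
have := avg_centered_sqr (primes_upto_prime (trunc_level R Y)) (primes_upto_uniq _) s1 (ltnW Y1).
rewrite -/(prime_mean R Y) -/mu exprVn r2 -mulrA mulVf ?mulr1; last by rewrite gt_eqF//; lra.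
move=> H; apply: (@le_trans _ _ (avg Y (fun l => 1 + normalized R Y l ^+ 2))).
  apply: le_avg => l _; have : normalized R Y l ^+ 2 = `|normalized R Y l| ^+ 2.
    by rewrite real_normK// num_real.
  by move=> ->; have := sqr_ge0 (`|normalized R Y l| - 1); have := normr_ge0 (normalized R Y l); nra.
rewrite avgD avg_cst ?(ltnW Y1)//.
under eq_avg => l _ do rewrite /normalized -/mu -/r mulrC.
lra.
Unshelve. all: end_near. Qed.

Lemma normalized_cdf_cvg (R : realType) (a : R) :
  avg Y (fun l => (normalized R Y l <= a)%R%:R : R) @[Y --> \oo] --> Phi a.
Proof. exact: (cdf_cvg (@normalized_cos_cvg R) (@normalized_tight R)). Qed.

(** * Decomposition of h-full numbers *)

Lemma prod_pow_gt0 (s : seq nat) (e : nat -> nat) : all prime s ->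
  (0 < \prod_(p <- s) p ^ e p)%N.
Proof.
move=> /allP ps; rewrite big_seq; apply: prodn_cond_gt0 => p /ps pp.
by rewrite expn_gt0 prime_gt0.
Qed.

Lemma logn_prod_pow (s : seq nat) (e : nat -> nat) q : all prime s -> uniq s ->
  logn q (\prod_(p <- s) p ^ e p) = (if q \in s then e q else 0)%N.
Proof.
elim: s => [|p s IH] /=; first by rewrite big_nil logn1.
move=> /andP[pp ps] /andP[pns us].
have e0 : (0 < p ^ e p)%N by rewrite expn_gt0 prime_gt0.
rewrite big_cons (lognM _ e0 (prod_pow_gt0 _ ps)) IH// inE lognX.
have [->|qp] := eqVneq q p; first by rewrite (negbTE pns) addn0 logn_prime// eqxx muln1.
by rewrite logn_prime// (negbTE qp) muln0.
Qed.

Lemma primes_all_prime n : all prime (primes n).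
Proof. by apply/allP => p; rewrite mem_primes => /and3P[]. Qed.

Definition power_free h b : bool := (0 < b)%N && all (fun p => logn p b < h)%N (primes b).

Definition twist h b : nat := \prod_(p <- primes b) p ^ (h + logn p b).

(** Recovers b from n = l^h * twist h b: both l^h and the twist change the exponents of b by
    multiples of h only. *)
Definition residual h n : nat := \prod_(p <- primes n) p ^ (logn p n %% h).

Lemma twist_gt0 h b : (0 < twist h b)%N.
Proof. exact/prod_pow_gt0/primes_all_prime. Qed.

Lemma residual_gt0 h n : (0 < residual h n)%N.
Proof. exact/prod_pow_gt0/primes_all_prime. Qed.

Lemma logn_twist h b p :
  logn p (twist h b) = (if p \in primes b then h + logn p b else 0)%N.
Proof. by rewrite logn_prod_pow ?primes_uniq// primes_all_prime. Qed.

Lemma logn_residual h n p : logn p (residual h n) = (logn p n %% h)%N.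
Proof.
rewrite logn_prod_pow ?primes_uniq ?primes_all_prime//.
by rewrite -logn_gt0; case: posnP => // ->; rewrite mod0n.
Qed.

Lemma logn_full h l b p : (0 < l)%N ->
  logn p (l ^ h * twist h b) =
  (h * logn p l + if p \in primes b then h + logn p b else 0)%N.
Proof. by move=> l0; rewrite lognM ?expn_gt0 ?l0 ?twist_gt0// lognX logn_twist. Qed.

Lemma h_full_twist h l b : (0 < l)%N -> h_full h (l ^ h * twist h b).
Proof.
move=> l0; split; first by rewrite muln_gt0 expn_gt0 l0 twist_gt0.
move=> p pp pn; have : (0 < logn p (l ^ h * twist h b))%N.
  by rewrite logn_gt0 mem_primes pp pn muln_gt0 expn_gt0 l0 twist_gt0.
rewrite logn_full//; case: ifP => _; first by lia.
by rewrite addn0 => H; rewrite leq_pmulr//; move: H; rewrite muln_gt0 => /andP[].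
Qed.

Lemma eqn_logn m n : (0 < m)%N -> (0 < n)%N -> (forall p, logn p m = logn p n) -> m = n.
Proof. by move=> m0 n0 E; apply: eqn_from_log. Qed.

Lemma residual_twist h l b : (0 < l)%N -> power_free h b ->
  residual h (l ^ h * twist h b) = b.
Proof.
move=> l0 /andP[b0 /allP bh]; apply: eqn_logn => //; first exact: residual_gt0.
move=> p; rewrite logn_residual logn_full// mulnC modnMDl.
case: ifPn => pb; first by rewrite modnDl modn_small// bh.
by rewrite mod0n; move: pb; rewrite -logn_gt0 -eqn0Ngt => /eqP.
Qed.

Lemma power_free_residual h n : (0 < h)%N -> power_free h (residual h n).
Proof.
move=> h0; rewrite /power_free residual_gt0; apply/allP => p _.
by rewrite logn_residual ltn_pmod.
Qed.

(** The factor l of n. If v_p(n) = h q + r with r > 0, the twist takes h + r of it, leaving q - 1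
    for l; for h-full n one has q >= 1 there, so the natural subtraction is exact. *)
Definition root_part h n : nat :=
  \prod_(p <- primes n) p ^ (logn p n %/ h - (0 < logn p n %% h)).

Lemma root_part_gt0 h n : (0 < root_part h n)%N.
Proof. exact/prod_pow_gt0/primes_all_prime. Qed.

Lemma h_full_decomp h n : (0 < h)%N -> h_full h n ->
  n = (root_part h n ^ h * twist h (residual h n))%N.
Proof.
move=> h0 [n0 nf]; apply: eqn_logn => // [|p].
  by rewrite muln_gt0 expn_gt0 root_part_gt0 twist_gt0.
rewrite logn_full ?root_part_gt0// logn_prod_pow ?primes_uniq ?primes_all_prime//.
rewrite -[p \in primes (residual h n)]logn_gt0 logn_residual.
case: ifPn => pn; last first.
  move: pn; rewrite -logn_gt0 -eqn0Ngt => /eqP ->.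
  by rewrite mod0n muln0.
have hv : (h <= logn p n)%N.
  by move: pn; rewrite mem_primes => /and3P[pp _ pn]; exact: nf.
have E := divn_eq (logn p n) h.
have q0 : (0 < logn p n %/ h)%N by rewrite divn_gt0.
case: (posnP (logn p n %% h)) => r0; first by move: E; rewrite r0 subn0 !addn0 mulnC.
move: E; rewrite mulnBr muln1 [in RHS]mulnC; nia.
Qed.

Lemma count_primes_upto (P : pred nat) y N : (y <= N)%N ->
  count P (primes_upto y) = count (fun p => (p <= y)%N && P p) (primes_upto N).
Proof.
move=> yN; rewrite -!size_filter; apply/perm_size/uniq_perm.
- exact/filter_uniq/primes_upto_uniq.
- exact/filter_uniq/primes_upto_uniq.
move=> p; rewrite mem_filter mem_primes_upto mem_filter mem_primes_upto.
case: (leqP p y) => py; rewrite ?andbF//= ?andbT.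
by rewrite (leq_trans py yN) andbT.
Qed.

Lemma count_primes (P : pred nat) n N : (0 < n)%N -> (n <= N)%N ->
  count P (primes n) = count (fun p => (p %| n)%N && P p) (primes_upto N).
Proof.
move=> n0 nN; rewrite -!size_filter; apply/perm_size/uniq_perm.
- exact/filter_uniq/primes_uniq.
- exact/filter_uniq/primes_upto_uniq.
move=> p; rewrite mem_filter mem_primes mem_filter mem_primes_upto n0 /=.
have [pn|pn] := boolP (p %| n)%N; rewrite ?andbF//= andbT.
by rewrite (leq_trans (dvdn_leq n0 pn) nN) andbT.
Qed.

Lemma count_le_sum (T : eqType) (a b c d : pred T) s :
  {in s, forall x, a x -> [|| b x, c x | d x]} ->
  (count a s <= count b s + count c s + count d s)%N.
Proof.
elim: s => //= x s IH H.
have := IH (fun y ys => H y (mem_behead (s := x :: s) ys)); have := H x (mem_head _ _).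
case: (a x); case: (b x); case: (c x); case: (d x) => /=; lia.
Qed.

Definition omega_upto y l : nat := count (fun p => p %| l)%N (primes_upto y).

Definition square_count Y l : nat := count (fun p => p ^ 2 %| l)%N (primes_upto Y).

Lemma centeredE (R : realType) y l :
  centered R (primes_upto y) l = (omega_upto y l)%:R - recip_sum R (primes_upto y).
Proof.
rewrite /centered sumrB; congr (_ - _).
by rewrite -natr_sum /omega_upto -sum1_count [in RHS]big_mkcond /=; congr _%:R; apply: eq_bigr => p _; case: (p %| l)%N.
Qed.

(** For p | b the exponent of p in n exceeds h, and otherwise it is h v_p(l), which equals h only
    for v_p(l) = 1. The free bound N lets several counts be compared over one list of primes. *)
Lemma omegah_full h l b N : (0 < h)%N -> (0 < l)%N -> (0 < b)%N ->
  (l ^ h * twist h b <= N)%N ->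
  omegah h (l ^ h * twist h b) =
  count (fun p => ~~ (p %| b) && (p %| l) && ~~ (p ^ 2 %| l))%N (primes_upto N).
Proof.
move=> h0 l0 b0 nN.
have n0 : (0 < l ^ h * twist h b)%N by rewrite muln_gt0 expn_gt0 l0 twist_gt0.
rewrite /omegah (count_primes _ n0 nN); apply: eq_in_count => p.
rewrite mem_primes_upto => /andP[pp pN].
have dv m : (0 < m)%N -> (p %| m)%N = (0 < logn p m)%N.
  by move=> m0; rewrite logn_gt0 mem_primes pp m0.
rewrite !(pfactor_dvdn _ pp)// (dv _ n0) (dv _ l0) logn_full// mem_primes pp b0 /=.
have [pb|pb] /= := boolP (p %| b)%N.
  have : (0 < logn p b)%N by rewrite logn_gt0 mem_primes pp b0.
  by move=> pb0; apply/negbTE; rewrite !negb_and negbK; apply/orP; right; apply/orP; right; lia.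
rewrite addn0; case: (logn p l) => [|[|v]]; rewrite ?muln0 ?muln1 ?ltnn ?leqnn ?h0 ?andbF//=.
by apply/negbTE; rewrite !negb_and !negbK; apply/orP; right; apply/orP; right; nia.
Qed.

(** * Integers with a fixed power-free part *)

Definition large_count Y y l : nat :=
  count (fun p => (y < p) && (p %| l))%N (primes_upto Y).

Lemma omegah_le_omega h l b Y y : (0 < h)%N -> (0 < l <= Y)%N -> (0 < b)%N -> (y <= Y)%N ->
  (omegah h (l ^ h * twist h b) <= omega_upto y l + large_count Y y l)%N.
Proof.
move=> h0 /andP[l0 lY] b0 yY.
set n := (l ^ h * twist h b)%N; pose N := (n + Y)%N.
have YN : (Y <= N)%N by rewrite leq_addl.
rewrite (@omegah_full h l b N)// ?leq_addr// /omega_upto /large_count.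
rewrite (count_primes_upto _ (leq_trans yY YN)) (count_primes_upto _ YN).
rewrite -[leqRHS]addn0 -(@count_pred0 nat (primes_upto N)).
apply: count_le_sum => p _ /andP[/andP[_ pl] _]; rewrite pl /= !andbT.
rewrite (leq_trans (dvdn_leq l0 pl) lY) orbF /=.
by case: leqP.
Qed.

(** A prime divisor of l is missed by omega_h only if it divides b or its square divides l. *)
Lemma omega_le_omegah h l b Y y : (0 < h)%N -> (0 < l <= Y)%N -> (0 < b)%N -> (y <= Y)%N ->
  (omega_upto y l <=
   omegah h (l ^ h * twist h b) + size (primes b) + square_count Y l)%N.
Proof.
move=> h0 /andP[l0 lY] b0 yY.
set n := (l ^ h * twist h b)%N; pose N := (n + Y + b)%N.
have YN : (Y <= N)%N by rewrite /N; lia.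
have nN : (n <= N)%N by rewrite /N -addnA leq_addr.
rewrite (@omegah_full h l b N)// /omega_upto /square_count.
rewrite (count_primes_upto _ (leq_trans yY YN)) (count_primes_upto _ YN).
have -> : size (primes b) = count predT (primes b) by rewrite count_predT.
rewrite (@count_primes _ b N)// ?leq_addl//.
apply: count_le_sum => p _ /andP[_ pl]; rewrite pl /= !andbT.
rewrite (leq_trans (dvdn_leq l0 pl) lY) /=.
by case: (p %| b)%N => //=; case: (p ^ 2 %| l)%N.
Qed.

(** The primes counted are distinct, so their product divides l. Since y + 1 exceeds Y^(1/u), there
    are at most u of them when l <= Y. *)
Lemma large_count_pow Y y l : (0 < l)%N -> (y.+1 ^ large_count Y y l <= l)%N.
Proof.
move=> l0; rewrite /large_count -size_filter; set s := [seq p <- _ | _].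
have us : uniq s by exact/filter_uniq/primes_upto_uniq.
have ps : all prime s.
  by apply/allP => p; rewrite mem_filter mem_primes_upto => /andP[_ /andP[]].
have sl : {in s, forall p, (p %| l)%N} by move=> p; rewrite mem_filter => /andP[/andP[]].
apply: leq_trans (dvdn_leq l0 (prodn_dvd ps us sl)).
have : all (fun p => y < p)%N s by apply/allP => p; rewrite mem_filter => /andP[/andP[]].
rewrite /prodn; elim: (s) => [|p r IH] /=; first by rewrite big_nil.
by move=> /andP[yp yr]; rewrite big_cons expnS leq_mul// IH.
Qed.

Lemma large_count_le (R : realType) Y l : 1 <= trunc_exp R Y -> (0 < l <= Y)%N ->
  (large_count Y (trunc_level R Y) l)%:R <= trunc_exp R Y.
Proof.
move=> u1 /andP[l0 lY]; have [_ lnY Y1] := trunc_exp_spec u1.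
have [_ yu] := trunc_level_bounds R Y.
have := large_count_pow Y (trunc_level R Y) l0; set m := large_count _ _ _.
set y := trunc_level R Y in yu *; set u := trunc_exp R Y in u1 yu * => ml.
have u0 : 0 < u by lra.
have y0 : 0 < (y.+1%:R : R) by [].
have : m%:R * ln y.+1%:R <= ln (Y%:R : R).
  rewrite mulr_natl -lnXn// ler_ln ?posrE ?exprn_gt0 ?ltr0n ?(ltnW Y1)//.
  by rewrite -natrX ler_nat (leq_trans ml).
have : ln (Y%:R : R) / u <= ln y.+1%:R.
  by rewrite -[leLHS]expRK ler_ln ?posrE ?expR_gt0// ltW.
rewrite ler_pdivrMr// => H1 H2.
rewrite -(ler_pM2r (_ : 0 < ln (y.+1%:R : R))).
  by rewrite [leRHS]mulrC (le_trans H2).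
by rewrite -(pmulr_lgt0 _ u0) (lt_le_trans _ H1)// (lt_trans ltr01).
Qed.

Lemma avg_square_count (R : realType) Y : (0 < Y)%N ->
  avg Y (fun l => (square_count Y l)%:R : R) <= 1.
Proof.
move=> Y0; apply: le_trans (recip_sqr_sum_le R Y).
have E l : (square_count Y l)%:R = \sum_(p <- primes_upto Y) (p ^ 2 %| l)%N%:R :> R.
  by rewrite -natr_sum /square_count -sum1_count big_mkcond /=; congr _%:R.
rewrite (eq_avg (fun l _ => E l)) avg_sum; apply: ler_sum => p _.
rewrite avg_dvd ler_pdivrMr ?ltr0n//.
case: p => [|p]; first by rewrite divn0 invr0 expr0n/= mul0r.
rewrite exprVn mulrC ler_pdivlMr ?exprn_gt0// -natrX -natrM ler_nat.
exact: leq_trunc_div.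
Qed.

Lemma avg_le_indic (R : realType) Y m : (0 < Y)%N ->
  avg Y (fun l => (l <= m)%N%:R : R) <= m%:R / Y%:R.
Proof.
move=> Y0; rewrite /avg ler_pM2r ?invr_gt0 ?ltr0n// -natr_sum ler_nat.
elim: Y {Y0} => [|Y IH]; first by rewrite big_geq.
rewrite big_nat_recr//=; case: (leqP Y.+1 m) => Ym; last by rewrite addn0.
rewrite addn1 (leq_trans _ Ym)// ltnS.
rewrite (@leq_trans (\sum_(1 <= l < Y.+1) 1))//; last by rewrite sum_nat_const_nat muln1 subn1.
by apply: leq_sum => i _; exact: leq_b1.
Qed.

Lemma ler_norm_sqrtB (R : realType) (A B : R) : 0 <= A -> 0 < B ->
  `|Num.sqrt A - Num.sqrt B| <= `|A - B| / Num.sqrt B.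
Proof.
move=> A0 B0; have b0 : 0 < Num.sqrt B by rewrite sqrtr_gt0.
have a0 := sqrtr_ge0 A; rewrite ler_pdivlMr//.
have -> : A - B = (Num.sqrt A - Num.sqrt B) * (Num.sqrt A + Num.sqrt B).
  by rewrite -subr_sqr !sqr_sqrtr// ltW.
by rewrite normrM ler_wpM2l// ger0_norm ?lerDr//.
Qed.

(** For l >= e Y with Y large, ln n lies between (ln Y)/2 and (h + 1) ln Y, so the iterated
    logarithms differ by at most max(ln 2, ln(h + 1)). *)
Lemma lnln_twist_bounds (R : realType) h l b Y (e : R) : (1 <= h)%N ->
  0 < e -> e < 1 -> 1 <= trunc_exp R Y -> ln (twist h b)%:R <= ln (Y%:R : R) ->
  - 2 * ln e <= ln (Y%:R : R) -> e * Y%:R <= l%:R -> (0 < l <= Y)%N ->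
  `|lnln R (l ^ h * twist h b) - lnln R Y| <= h%:R + 1.
Proof.
move=> h1 e0 e1 u1 kY eY el /andP[l0 lY].
have [LE lY1 Y1] := trunc_exp_spec u1.
set n := (l ^ h * twist h b)%N.
have Y0 : 0 < (Y%:R : R) by rewrite ltr0n ltnW.
have k0 := twist_gt0 h b; have lr : 0 < (l%:R : R) by rewrite ltr0n.
have nE : ln (n%:R : R) = h%:R * ln l%:R + ln (twist h b)%:R.
  by rewrite /n natrM natrX lnM ?posrE ?exprn_gt0 ?ltr0n// lnXn// mulr_natl.
have lnk := ln_nat_ge0 R (twist h b).
have lnl : ln (l%:R : R) <= ln Y%:R by exact: le_ln_nat.
have lnl2 : ln Y%:R / 2 <= ln (l%:R : R).
  have : ln (e * Y%:R) <= ln (l%:R : R) by rewrite ler_ln ?posrE ?mulr_gt0.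
  by rewrite lnM ?posrE//; lra.
have hr : 1 <= (h%:R : R) by rewrite ler1n.
have up : ln (n%:R : R) <= (h%:R + 1) * ln Y%:R by rewrite nE; nra.
have lo : ln Y%:R / 2 <= ln (n%:R : R) by rewrite nE; nra.
have lY0 : 0 < ln (Y%:R : R) by lra.
have ln0 : 0 < ln (n%:R : R) by lra.
have up2 : lnln R n <= lnln R Y + (h%:R + 1).
  rewrite /lnln (@le_trans _ _ (ln ((h%:R + 1) * ln Y%:R)))//.
    by rewrite ler_ln ?posrE// mulr_gt0//; lra.
  have h10 : 0 < h%:R + 1 :> R by lra.
  rewrite lnM ?posrE//.
  by rewrite addrC lerD2l ltW// ln_sublinear//; lra.
have lo2 : lnln R Y <= lnln R n + 1.
  rewrite /lnln (@le_trans _ _ (ln (2 * ln (n%:R : R))))//.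
    by rewrite ler_ln ?posrE//; lra.
  rewrite lnM ?posrE// addrC lerD2l (_ : 2 = 1 + 1 :> R); last by ring.
  by apply: le_ln1Dx; rewrite (@lt_trans _ _ 0)// ltrN10.
by rewrite ler_norml; apply/andP; split; lra.
Qed.

Definition ek_cond (R : realType) h (a : R) n : bool :=
  (3 <= n)%N && (((omegah h n)%:R - lnln R n) / Num.sqrt (lnln R n) <= a).

Lemma lnln_ge1 (R : realType) n : 1 <= lnln R n -> (3 <= n)%N.
Proof.
move=> L1; have l0 : 0 < ln (n%:R : R).
  rewrite ltNge; apply: contraTN L1 => l0; rewrite -ltNge /lnln.
  by rewrite (le_lt_trans (ln_le0 (le_trans l0 _))).
have n0 : 0 < (n%:R : R).
  by rewrite ltr0n lt0n; apply: contraTneq l0 => ->; rewrite ln0// ltxx.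
have : expR 1 <= ln (n%:R : R) by rewrite -[leRHS]lnK ?posrE// ler_expR.
have := expR_ge1Dx (1 : R) => e1 e2.
have : expR 2 <= (n%:R : R) by rewrite -[leRHS]lnK ?posrE// ler_expR; lra.
have := expR_ge1Dx (2 : R); rewrite -(ler_nat R); lra.
Qed.

(* The hypotheses hold off a set of l of small proportion; they put omega_h(n),
   ln ln n and its square root, for n = l^h * twist h b, within d * sqrt mu of
   omega_upto y l, mu and sqrt mu, where mu = prime_mean Y. *)
Lemma ek_cond_normalized (R : realType) h b (a d C : R) Y l :
  (0 < h)%N -> (0 < b)%N -> 0 < d -> (0 < l <= Y)%N ->
  1 <= trunc_exp R Y -> h%:R + 2 <= trunc_exp R Y ->
  1 <= prime_mean R Y -> (trunc_level R Y <= Y)%N ->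
  `|prime_mean R Y - lnln R Y| <= C + 2 * trunc_exp R Y ->
  `|lnln R (l ^ h * twist h b) - lnln R Y| <= h%:R + 1 ->
  C + h%:R + 1 + (size (primes b))%:R + 3 * trunc_exp R Y <= d * Num.sqrt (prime_mean R Y) ->
  (square_count Y l)%:R <= trunc_exp R Y -> 0 <= C ->
  (ek_cond h a (l ^ h * twist h b) -> normalized R Y l <= a + (2 + `|a|) * d) /\
  (normalized R Y l <= a - (2 + `|a|) * d -> ek_cond h a (l ^ h * twist h b)).
Proof.
move=> h0 b0 d0 ly u1 uh m1 yY muL nL T sq C0.
have [LE _ _] := trunc_exp_spec u1.
have w1 := omegah_le_omega h0 ly b0 yY; have w2 := omega_le_omegah h0 ly b0 yY.
have lc := large_count_le u1 ly.
move: w1 w2; rewrite /ek_cond /normalized centeredE -/(prime_mean R Y).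
set n := (l ^ h * twist h b)%N in nL *; set y := trunc_level R Y in yY lc *.
rewrite -!(ler_nat R) !natrD.
move: nL muL T; rewrite LE; set u := trunc_exp R Y in u1 uh lc sq LE *.
set A := lnln R n; set mu := prime_mean R Y in m1 *; set r := Num.sqrt mu.
set w := (omegah h n)%:R; set o := (omega_upto y l)%:R; set B := (size _)%:R.
set S := (square_count Y l)%:R in sq *; set G := (large_count Y y l)%:R in lc *.
move=> nL muL T w1 w2.
have B0 : 0 <= B by [].
have h1 : 1 <= (h%:R : R) by rewrite ler1n.
have u4 : u <= u ^+ 4 by rewrite ler_eXnr.
have r2 : r ^+ 2 = mu by rewrite sqr_sqrtr//; lra.
have r1 : 1 <= r.
  by rewrite -[leLHS]sqrtr1 ler_sqrt//; lra.
have A1 : 1 <= A by move: nL; rewrite ler_norml => /andP[]; lra.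
have n3 : (3 <= n)%N by apply: lnln_ge1 A1.
have rho0 : 0 < Num.sqrt A by rewrite sqrtr_gt0; lra.
(* Both A = ln ln n and mu are close to u^4 = ln ln Y. *)
have F1 : `|A - mu| <= d * r.
  have -> : A - mu = (A - u ^+ 4) - (mu - u ^+ 4) by ring.
  by rewrite (le_trans (ler_normB _ _))//; lra.
have r0 : 0 < r by lra.
have F3 : `|Num.sqrt A - r| <= d.
  apply: (le_trans (ler_norm_sqrtB _ _)); [lra|lra|].
  by rewrite -/r ler_pdivrMr.
have F4 : `|a * (Num.sqrt A - r)| <= `|a| * d * r.
  rewrite normrM -mulrA ler_wpM2l// (le_trans F3)// ler_peMr//; exact: ltW.
move: F1 F4; rewrite !ler_norml => /andP[F1 F1'] /andP[F4 F4'].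
(* In the shift (2 + |a|) d, one d pays for A against mu, one for the primes on which the two counts
   differ, and |a| d for replacing sqrt A by r. *)
split.
  move=> /andP[_]; rewrite ler_pdivrMr// => H.
  by rewrite ler_pdivrMr//; lra.
rewrite ler_pdivrMr// => H; rewrite ler_nat n3 /= ler_pdivrMr//; lra.
Qed.

Lemma twisted_cdf_cvg (R : realType) h b (a : R) : (0 < h)%N -> (0 < b)%N ->
  avg Y (fun l => (ek_cond h a (l ^ h * twist h b))%:R : R) @[Y --> \oo] --> Phi a.
Proof.
move=> h0 b0; apply/cvgrPdist_le => e0 e00.
(* The losses are e each for the shift of a, the convergence of [normalized], and the two
   exceptional sets. *)
pose e := Num.min (e0 / 5) (1 / 2).
have e_gt0 : 0 < e by rewrite lt_min !divr_gt0.
have ee0 : 5 * e <= e0.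
  have : e <= e0 / 5 by rewrite ge_min lexx.
  by lra.
have e1 : e < 1.
  have : e <= 1 / 2 by rewrite ge_min lexx orbT.
  by lra.
have a2 : 0 < 2 + `|a| by have := normr_ge0 a; lra.
pose d := e / (2 + `|a|); have d0 : 0 < d by rewrite divr_gt0.
have dE : (2 + `|a|) * d = e by rewrite mulrC divfK// gt_eqF.
have [C1 HC] := near_prime_mean R; pose C := `|C1|.
have C0 : 0 <= C by exact: normr_ge0.
have cvU := @normalized_cdf_cvg R (a + e); have cvL := @normalized_cdf_cvg R (a - e).
have P1 : Phi (a + e) <= Phi a + (a + e - a) by apply: Phi_lipschitz; lra.
have P2 : Phi a <= Phi (a - e) + (a - (a - e)) by apply: Phi_lipschitz; lra.
near=> Y.
have u1 : 1 <= trunc_exp R Y by near: Y; exact: near_trunc_exp_ge.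
have uh : h%:R + 2 <= trunc_exp R Y by near: Y; exact: near_trunc_exp_ge.
have uC : C + h%:R + 1 + (size (primes b))%:R <= trunc_exp R Y by near: Y; exact: near_trunc_exp_ge.
have ud : 8 / d <= trunc_exp R Y by near: Y; exact: near_trunc_exp_ge.
have ue : e^-1 <= trunc_exp R Y by near: Y; exact: near_trunc_exp_ge.
have ulk : ln (twist h b)%:R <= trunc_exp R Y by near: Y; exact: near_trunc_exp_ge.
have ule : - 2 * ln e <= trunc_exp R Y by near: Y; exact: near_trunc_exp_ge.
have m1 : 1 <= prime_mean R Y by near: Y; exact: near_prime_mean_ge_cst.
have m2 : lnln R Y / 2 <= prime_mean R Y by near: Y; exact: near_prime_mean_ge.
have muL : `|prime_mean R Y - lnln R Y| <= C1 + 2 * trunc_exp R Y by near: Y.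
have fU : `|Phi (a + e) - avg Y (fun l => (normalized R Y l <= a + e)%R%:R)| <= e.
  by near: Y; exact: (cvgr_dist_le _ _ cvU).
have fL : `|Phi (a - e) - avg Y (fun l => (normalized R Y l <= a - e)%R%:R)| <= e.
  by near: Y; exact: (cvgr_dist_le _ _ cvL).
have [LE lY Y1] := trunc_exp_spec u1; have [yl _] := trunc_level_bounds R Y.
have Y0 : (0 < Y)%N by exact: ltnW.
have Yr : 0 < (Y%:R : R) by rewrite ltr0n.
set u := trunc_exp R Y in u1 uh uC ud ue ulk ule muL LE yl *.
have u0 : 0 < u by lra.
have ulY : u <= ln (Y%:R : R).
  have -> : ln (Y%:R : R) = expR (u ^+ 4) by rewrite -LE /lnln lnK// posrE (lt_trans ltr01).
  have : u <= u ^+ 4 by rewrite ler_eXnr.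
  by have := expR_ge1Dx (u ^+ 4); lra.
have yY : (trunc_level R Y <= Y)%N.
  rewrite -(ler_nat R) (le_trans yl)// -[leRHS]lnK ?posrE// ler_expR.
  by rewrite ler_pdivrMr// ler_peMr//; lra.
have muL' : `|prime_mean R Y - lnln R Y| <= C + 2 * u.
  by rewrite (le_trans muL)// lerD2r ler_norm.
(* Since mu >= u^4 / 2, sqrt mu >= u^2 / 2; with u >= 8/d the right side is at least 4u. *)
have T : C + h%:R + 1 + (size (primes b))%:R + 3 * u <= d * Num.sqrt (prime_mean R Y).
  have ur : u ^+ 2 / 2 <= Num.sqrt (prime_mean R Y).
    have s0 : 0 <= u ^+ 2 / 2 by rewrite divr_ge0// sqr_ge0.
    rewrite -(ler_pXn2r (n := 2)) ?nnegrE ?sqrtr_ge0// (sqr_sqrtr (le_trans ler01 m1)).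
    apply: le_trans m2; rewrite LE exprMn -exprM exprVn.
    have : 0 <= u ^+ 4 by rewrite exprn_ge0// ltW.
    by rewrite -[(2 * 2)%N]/4%N; lra.
  have : d * (u ^+ 2 / 2) <= d * Num.sqrt (prime_mean R Y) by rewrite ler_wpM2l// ltW.
  apply: le_trans; move: ud; rewrite ler_pdivrMr//; nra.
pose m := Num.truncn (e * Y%:R).
have mY : m%:R <= e * Y%:R by rewrite truncn_le// mulr_ge0// ltW.
(* Markov's inequality in pointwise form: x and y are nonnegative, and one of them is at least 1
   wherever the implication from P to Q may fail. *)
have le_indic_of (P Q : bool) (x y : R) : 0 <= x -> 0 <= y -> (x < 1 -> y < 1 -> P -> Q) ->
    P%:R <= Q%:R + x + y.
  move=> x0 y0; case: P => /=; last by move=> _; rewrite !addr_ge0.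
  case: Q => /= H; first by lra.
  by rewrite leNgt; apply/negP => H1; have : false by apply: H => //; lra.
have good l : (0 < l <= Y)%N -> ((l <= m)%N%:R : R) < 1 -> ((square_count Y l)%:R / u : R) < 1 ->
    (ek_cond h a (l ^ h * twist h b) -> normalized R Y l <= a + e) /\
    (normalized R Y l <= a - e -> ek_cond h a (l ^ h * twist h b)).
  move=> ly lm sq; rewrite -dE.
  have lm' : (m < l)%N by move: lm; case: leqP => //=; rewrite ltxx.
  have sq' : (square_count Y l)%:R <= u by move: sq; rewrite ltr_pdivrMr// mul1r => /ltW.
  have el : e * Y%:R <= l%:R by rewrite ltW// (lt_le_trans (truncnS_gt _))// ler_nat.
  have nL := lnln_twist_bounds h0 e_gt0 e1 u1 (le_trans ulk ulY) (le_trans ule ulY) el ly.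
  exact: ek_cond_normalized nL T sq' C0.
have avgs : avg Y (fun l => (square_count Y l)%:R / u) <= e.
  rewrite (eq_avg (fun l _ => mulrC _ _)) avgZ.
  have := avg_square_count R Y0; set s := avg _ _ => s1.
  have s0 : 0 <= s by rewrite divr_ge0// sumr_ge0.
  have : u^-1 <= e by rewrite -[leRHS]invrK lef_pV2 ?posrE ?invr_gt0.
  have : 0 < u^-1 by rewrite invr_gt0.
  nra.
have avgm : avg Y (fun l => (l <= m)%N%:R : R) <= e.
  by apply: le_trans (avg_le_indic R m Y0) _; rewrite ler_pdivrMr.
have U : avg Y (fun l => (ek_cond h a (l ^ h * twist h b))%:R) <=
    avg Y (fun l => (normalized R Y l <= a + e)%R%:R) + e + e.
  apply: (@le_trans _ _ (avg Y (fun l => (normalized R Y l <= a + e)%R%:R + (l <= m)%N%:R +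
    (square_count Y l)%:R / u))).
    apply: le_avg => l ly; apply: le_indic_of => //; first by rewrite divr_ge0// ltW.
    by move=> x1 y1; have [] := good l ly x1 y1.
  by rewrite !avgD; lra.
have L : avg Y (fun l => (normalized R Y l <= a - e)%R%:R) <=
    avg Y (fun l => (ek_cond h a (l ^ h * twist h b))%:R) + e + e.
  apply: (@le_trans _ _ (avg Y (fun l => (ek_cond h a (l ^ h * twist h b))%:R + (l <= m)%N%:R +
    (square_count Y l)%:R / u))).
    apply: le_avg => l ly; apply: le_indic_of => //; first by rewrite divr_ge0// ltW.
    by move=> x1 y1; have [] := good l ly x1 y1.
  by rewrite !avgD; lra.
move: fU fL; rewrite !ler_norml => /andP[? ?] /andP[? ?].
by apply/andP; split; lra.
Unshelve. all: end_near. Qed.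

(** * Counting h-full numbers *)

Lemma card_fset_set_nat (S : set nat) N : (forall n, S n -> (0 < n <= N)%N) ->
  #|` fset_set S| = count (fun n => `[< S n >]) (index_iota 1 N.+1).
Proof.
move=> SN; have fS : finite_set S.
  by apply: (@sub_finite_set _ _ `I_N.+1); [move=> n /SN /andP[]|exact: finite_II].
have -> : fset_set S = [fset n in [seq n <- index_iota 1 N.+1 | `[< S n >]]]%fset.
  apply/fsetP => n; rewrite in_fset_set// !inE mem_filter mem_index_iota ltnS.
  apply/idP/idP => [/set_mem Sn|/andP[/asboolP Sn _]]; last exact/mem_set.
  by rewrite SN// andbT; apply/asboolP.
by rewrite card_fseq undup_id ?size_filter// filter_uniq// iota_uniq.
Qed.

(** The integer part of (N/t)^(1/h). For positive h and t the range l <= N loses nothing, as l <=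
    l^h * t. *)
Definition root_floor h t N : nat :=
  (\max_(l < N.+1 | l ^ h * t <= N) l)%N.

Lemma root_floorP h t N l : (0 < h)%N -> (0 < t)%N ->
  (l ^ h * t <= N)%N = (l <= root_floor h t N)%N.
Proof.
move=> h0 t0.
have [i Hi E] : {i : 'I_N.+1 | (i ^ h * t <= N)%N & root_floor h t N = i}.
  rewrite /root_floor; apply: (@eq_bigmax_cond _ (fun l : 'I_N.+1 => (l ^ h * t <= N)%N) (fun l : 'I_N.+1 => l : nat)).
  apply/card_gt0P; exists ord0; rewrite unfold_in /=.
  by rewrite exp0n.
apply/idP/idP => [lN|]; last first.
  rewrite E => li; apply: leq_trans Hi; rewrite leq_mul2r; apply/orP; right.
  by rewrite leq_exp2r.
have lN1 : (l < N.+1)%N.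
  rewrite ltnS (leq_trans _ lN)//; case: (l) => // k.
  rewrite (leq_trans _ (leq_pmulr _ t0))//.
  by rewrite -{1}(expn1 k.+1) leq_pexp2l.
exact: (@leq_bigmax_cond _ _ (fun l : 'I_N.+1 => l : nat) (Ordinal lN1)).
Qed.

Lemma residual_le h n : (0 < n)%N -> (residual h n <= n)%N.
Proof.
move=> n0; have {2}-> : n = (\prod_(p <- primes n) p ^ logn p n)%N.
  apply: eqn_logn => // [|p]; first exact/prod_pow_gt0/primes_all_prime.
  rewrite logn_prod_pow ?primes_uniq ?primes_all_prime// -logn_gt0.
  by case: posnP.
rewrite /residual big_seq [leqRHS]big_seq; apply: leq_prod => p.
rewrite mem_primes => /and3P[pp _ _].
by rewrite leq_exp2l ?prime_gt1// leq_mod.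
Qed.

(** A general predicate Q, so that one bijection between n and the pairs (b, l) serves numerator and
    denominator. *)
Lemma count_h_full h N (Q : pred nat) : (0 < h)%N ->
  count (fun n => `[< h_full h n >] && Q n) (index_iota 1 N.+1) =
  (\sum_(b <- index_iota 1 N.+1 | power_free h b)
    \sum_(1 <= l < (root_floor h (twist h b) N).+1) Q (l ^ h * twist h b))%N.
Proof.
move=> h0; rewrite -size_filter.
pose bs := [seq b <- index_iota 1 N.+1 | power_free h b].
pose ls b := [seq l <- index_iota 1 (root_floor h (twist h b) N).+1 | Q (l ^ h * twist h b)%N].
pose s2 := [seq (l ^ h * twist h b)%N | b <- bs, l <- ls b].
have -> : size [seq n <- index_iota 1 N.+1 | `[< h_full h n >] && Q n] = size s2.
  apply/perm_size/uniq_perm.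
  - exact/filter_uniq/iota_uniq.
  - apply: allpairs_uniq_dep.
    + exact/filter_uniq/iota_uniq.
    + by move=> b _; exact/filter_uniq/iota_uniq.
    move=> [b l] [b' l'] /allpairsPdep[b1 [l1 [bb1 ll1 [-> ->]]]] /allpairsPdep[b2 [l2 [bb2 ll2 [-> ->]]]].
    move: bb1 bb2 ll1 ll2; rewrite !mem_filter !mem_index_iota.
    move=> /andP[p1 _] /andP[p2 _] /andP[_ /andP[l10 _]] /andP[_ /andP[l20 _]] /= E.
    have bE : b1 = b2 by rewrite -(residual_twist l10 p1) E residual_twist.
    rewrite bE in E *; congr (Tagged _ _).
    move/eqP: E; rewrite eqn_pmul2r ?twist_gt0// eqn_exp2r//; by move/eqP.
  move=> n; apply/idP/idP.
    rewrite mem_filter mem_index_iota ltnS => /andP[/andP[/asboolP nf Qn] /andP[n0 nN]].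
    have E := h_full_decomp h0 nf.
    apply/allpairsPdep; exists (residual h n), (root_part h n); split=> //.
      rewrite mem_filter power_free_residual// mem_index_iota residual_gt0 /= ltnS.
      exact: leq_trans (residual_le h n0) nN.
    rewrite mem_filter -E Qn mem_index_iota root_part_gt0 /= ltnS.
    by rewrite -root_floorP ?twist_gt0// -E.
  move=> /allpairsPdep[b [l [+ + ->]]]; rewrite !mem_filter !mem_index_iota.
  move=> /andP[pb _] /andP[Ql /andP[l0 lY]]; rewrite Ql andbT.
  apply/andP; split; first by apply/asboolP; exact: h_full_twist.
  rewrite ltnS in lY; rewrite ltnS (root_floorP _ _ h0 (twist_gt0 _ _)) lY andbT.
  by rewrite muln_gt0 expn_gt0 l0 twist_gt0.
rewrite size_allpairs_dep sumnE big_map big_filter; apply: eq_bigr => b _.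
by rewrite size_filter -sum1_count big_mkcond /=; apply: eq_bigr => l _; case: (Q _).
Qed.

(** This is rad(b)^-(1 + 1/h). It dominates twist(b)^(-1/h), since every exponent h + v_p(b) in the
    twist is at least h + 1, and it is a product over the primes of b. *)
Definition weight (R : realType) h b : R :=
  expR (- (1 + h%:R^-1) * ln (prodn (primes b))%:R).

Lemma weight_ge0 (R : realType) h b : 0 <= weight R h b.
Proof. exact: expR_ge0. Qed.

Lemma twist1 h : twist h 1 = 1%N.
Proof. by rewrite /twist big_nil. Qed.

Lemma rad_pow_le_twist h b : (prodn (primes b) ^ h.+1 <= twist h b)%N.
Proof.
have E : (prodn (primes b) ^ h.+1 = \prod_(p <- primes b) p ^ h.+1)%N.
  rewrite /prodn; elim: (primes b) => [|p s IH]; first by rewrite !big_nil exp1n.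
  by rewrite !big_cons expnMn IH.
rewrite E /twist big_seq [leqRHS]big_seq; apply: leq_prod => p pb.
move: (pb); rewrite mem_primes => /and3P[pp _ _].
by rewrite leq_exp2l ?prime_gt1// -addn1 leq_add2l logn_gt0.
Qed.

(** The h-th power of Yb rad(b)^(1 + 1/h) is at most N, and N < (Y1 + 1)^h <= (2 Y1)^h; the factor 2
    pays for rounding. *)
Lemma root_floor_weight (R : realType) h b N : (0 < h)%N -> (0 < N)%N ->
  (root_floor h (twist h b) N)%:R <= 2 * weight R h b * (root_floor h (twist h 1) N)%:R.
Proof.
move=> h0 N0; rewrite twist1.
set Yb := root_floor h (twist h b) N; set Y1 := root_floor h 1 N.
have Y10 : (0 < Y1)%N by rewrite /Y1 -root_floorP// exp1n.
case: (posnP Yb) => [->|Yb0]; first by rewrite !mulr_ge0// weight_ge0.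
have tw0 := twist_gt0 h b.
have H1 : (Yb ^ h * prodn (primes b) ^ h.+1 <= N)%N.
  apply: (@leq_trans (Yb ^ h * twist h b)); last by rewrite root_floorP.
  by rewrite leq_mul2l rad_pow_le_twist orbT.
have H2 : (N < (Y1 + Y1) ^ h)%N.
  apply: (@leq_trans (Y1.+1 ^ h)); last by rewrite leq_exp2r//; lia.
  by rewrite ltnNge -(muln1 (_ ^ _)%N) root_floorP// ltnn.
have r0 : (0 < prodn (primes b))%N by exact/seqprod_gt0/primes_all_prime.
have hr : 0 < (h%:R : R) by rewrite ltr0n.
have : ln ((Yb ^ h * prodn (primes b) ^ h.+1)%:R : R) <= ln ((Y1 + Y1) ^ h)%:R.
  by apply: le_ln_nat; [rewrite muln_gt0 !expn_gt0 Yb0 r0|exact: leq_trans H1 (ltnW H2)].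
rewrite natrM !natrX lnM ?posrE ?exprn_gt0 ?ltr0n//.
rewrite !lnXn ?ltr0n ?addn_gt0 ?Y10// -!(mulr_natl (ln _)) -(natr1 h).
set a := ln Yb%:R; set c := ln (prodn _)%:R; set d := ln (Y1 + Y1)%:R => H.
have H' : a <= - (1 + h%:R^-1) * c + d.
  rewrite -(ler_pM2l hr) mulrDr.
  have -> : h%:R * (- (1 + h%:R^-1) * c) = - (h%:R + 1) * c by field; rewrite gt_eqF.
  lra.
rewrite -[Yb%:R]lnK ?posrE ?ltr0n// -/a.
apply: (@le_trans _ _ (expR (- (1 + h%:R^-1) * c + d))); first by rewrite ler_expR.
rewrite expRD lnK ?posrE ?ltr0n ?addn_gt0 ?Y10// natrD.
by rewrite /weight -/c; lra.
Qed.

Definition zeta_term (R : realType) h n : R := expR (- (1 + h%:R^-1) * ln n%:R).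

Lemma weight_prod (R : realType) h b :
  weight R h b = \prod_(p <- primes b) zeta_term R h p.
Proof.
rewrite /weight /prodn; have := primes_all_prime b; elim: (primes b) => [|p s IH] /=.
  by rewrite !big_nil ln1 mulr0 expR0.
move=> /andP[pp ps]; rewrite !big_cons natrM lnM ?posrE ?ltr0n; last 2 first.
- exact: prime_gt0.
- exact: (seqprod_gt0 ps).
by rewrite mulrDr expRD IH.
Qed.

(* By e^t >= 1 + t, n^(-c) * c / n <= (n-1)^(-c) - n^(-c), which telescopes. *)
Lemma sum_zeta_term (R : realType) h N : (0 < h)%N ->
  \sum_(1 <= n < N.+1) zeta_term R h n <= h%:R + 1.
Proof.
move=> h0; have hr : 0 < (h%:R : R) by rewrite ltr0n.
set c := (h%:R^-1 : R); have c0 : 0 < c by rewrite invr_gt0.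
suff H : (0 < N)%N -> \sum_(1 <= n < N.+1) zeta_term R h n <= h%:R + 1 - h%:R * expR (- c * ln N%:R).
  case: N H => [|N] H; first by rewrite big_geq// addr_ge0// ltW.
  by rewrite (le_trans (H _))// lerBlDr lerDl mulr_ge0 ?expR_ge0// ltW.
elim: N => // N IH _; case: N IH => [|N] IH.
  by rewrite big_nat1 /zeta_term ln1 !mulr0 expR0 mulr1; lra.
rewrite big_nat_recr//= (le_trans (lerD (IH isT) (lexx _)))//.
have [_ +] := ln_succ_bounds R (ltn0Sn N).
set x := N.+1; set a := ln x%:R; set b := ln x.+1%:R => ab.
have zE : zeta_term R h x.+1 = expR (- c * b) * (x.+1%:R)^-1.
  rewrite /zeta_term -/b -[(x.+1%:R)^-1]lnK ?posrE ?invr_gt0 ?ltr0n//.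
  rewrite lnV ?posrE ?ltr0n// -expRD -/b; congr expR; rewrite -/c; ring.
have eE : expR (- c * a) = expR (- c * b) * expR (c * (b - a)).
  by rewrite -expRD; congr expR; ring.
have hc : h%:R * c = 1 by rewrite mulfV// gt_eqF.
have : 1 + c * (x.+1%:R)^-1 <= expR (c * (b - a)).
  by apply: le_trans (expR_ge1Dx _); rewrite lerD2l ler_pM2l.
rewrite zE eE; have := expR_gt0 (- c * b); set E := expR (- c * b); set G := expR _.
set i := (x.+1%:R)^-1 => E0 H.
have := ler_wpM2l (ltW (mulr_gt0 hr E0)) H.
have -> : h%:R * E * (1 + c * i) = h%:R * E + (h%:R * c) * E * i by ring.
rewrite hc; lra.
Qed.

(* Euler product bound: an h-power-free b is determined by its exponents, so the
   sum is at most prod_p (1 + (h - 1) p^-(1 + 1/h)). *)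
Lemma sum_weight_le (R : realType) h N : (0 < h)%N ->
  \sum_(b <- index_iota 1 N.+1 | power_free h b) weight R h b <=
  expR (h%:R * (h%:R + 1)).
Proof.
case: h => // h _; set k := h.+1.
(* Local factors indexed by the exponent r < h. Coding b by its exponent function is injective, so
   the sum is part of the expansion of the product over p of the sums over r. *)
pose F (p : 'I_N.+1) (r : 'I_k) : R :=
  if r == ord0 then 1 else if prime p then zeta_term R k p else 0.
have F0 p r : 0 <= F p r.
  by rewrite /F; case: ifP => // _; case: ifP => // _; exact: expR_ge0.
pose code b : {ffun 'I_N.+1 -> 'I_k} := [ffun p : 'I_N.+1 => inord (logn p b)].
pose bs := [seq b <- index_iota 1 N.+1 | power_free k b].
have bsP b : b \in bs -> [/\ (0 < b <= N)%N & forall p, (logn p b < k)%N].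
  rewrite mem_filter mem_index_iota ltnS => /andP[/andP[_ /allP H] ->]; split=> // p.
  have [/H//|] := boolP (p \in primes b).
  by rewrite -logn_gt0 -eqn0Ngt => /eqP ->.
have codeE b (p : 'I_N.+1) : b \in bs -> code b p = logn p b :> nat.
  by move=> /bsP[_ H]; rewrite ffunE inordK.
have wE b : b \in bs -> weight R k b = \prod_(p : 'I_N.+1) F p (code b p).
  move=> bb; have [/andP[b0 bN] _] := bsP _ bb; rewrite weight_prod.
  have P : perm_eq (primes b) [seq p <- index_iota 0 N.+1 | p \in primes b].
    apply: uniq_perm; [exact: primes_uniq|exact/filter_uniq/iota_uniq|].
    move=> p; rewrite mem_filter mem_index_iota leq0n ltnS /=.
    have [pb|] := boolP (p \in primes b) => //=; apply/esym.
    move: pb; rewrite mem_primes => /and3P[_ _ /(dvdn_leq b0) pb].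
    exact: leq_trans pb bN.
  rewrite (perm_big _ P) big_filter big_mkcond big_mkord.
  apply: eq_bigr => p _; rewrite /F -val_eqE /= codeE// -(logn_gt0 p b).
  case: posnP => // lp; rewrite ifT//.
  by move: lp; rewrite logn_gt0 mem_primes => /and3P[].
rewrite -big_filter -/bs.
have -> : \sum_(b <- bs) weight R k b = \sum_(f <- map code bs) \prod_(p : 'I_N.+1) F p (f p).
  by rewrite big_map big_seq [RHS]big_seq; apply: eq_bigr => b; exact: wE.
have ucode : uniq (map code bs).
  rewrite map_inj_in_uniq; first exact/filter_uniq/iota_uniq.
  move=> b b' bb bb' E; have [/andP[b0 bN] _] := bsP _ bb; have [/andP[b0' bN'] _] := bsP _ bb'.
  apply: eqn_logn => // p; have [pN|pN] := leqP N.+1 p.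
    have log0 c : (0 < c)%N -> (c <= N)%N -> logn p c = 0%N.
      move=> c0 cN; apply/eqP; rewrite eqn0Ngt logn_gt0 mem_primes.
      by apply/negP => /and3P[_ _ /(dvdn_leq c0)]; lia.
    by rewrite !log0.
  by rewrite -(codeE b (Ordinal pN))// E codeE.
rewrite big_uniq//=.
apply: (@le_trans _ _ (\sum_(f : {ffun 'I_N.+1 -> 'I_k}) \prod_(p : 'I_N.+1) F p (f p))).
  rewrite big_mkcond; apply: ler_sum => f _; case: ifP => // _.
  by apply: prodr_ge0 => p _.
rewrite -(bigA_distr_bigA F) /=.
(* At index 0 the default ln 0 = 0 would give [zeta_term] the value 1; as 0 is not prime its factor
   is 1, and the exponent there is set to 0. *)
have FE (p : 'I_N.+1) : \sum_(r < k) F p r <= expR (if p == ord0 then 0 else k%:R * zeta_term R k p).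
  rewrite big_ord_recl /= {1}/F eqxx.
  have -> : \sum_(i < h) F p (lift ord0 i) = h%:R * (if prime p then zeta_term R k p else 0).
    rewrite (eq_bigr (fun=> (if prime p then zeta_term R k p else 0))); last by move=> i _.
    by rewrite sumr_const card_ord mulr_natl.
  apply: le_trans (expR_ge1Dx _); rewrite lerD2l.
  have [->|_] := eqVneq p ord0; first by rewrite /= mulr0.
  apply: ler_pM => //; first by case: ifP => // _; exact: expR_ge0.
    by rewrite ler_nat.
  by case: ifP => // _; exact: expR_ge0.
apply: (@le_trans _ _ (\prod_(p < N.+1) expR (if p == ord0 then 0 else k%:R * zeta_term R k p))).
  by apply: ler_prod => p _; rewrite FE sumr_ge0.
rewrite -expR_sum ler_expR big_ord_recl /= add0r -mulr_sumr ler_pM2l ?ltr0n//.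
apply: le_trans (sum_zeta_term R N (ltn0Sn h)).
by rewrite big_add1 /= big_mkord.
Qed.

(** The partial sums are bounded; B is an index at which they come within e of their supremum. *)
Lemma weight_tail (R : realType) h (e : R) : (0 < h)%N -> 0 < e ->
  exists B, forall N, \sum_(b <- index_iota 1 N.+1 | power_free h b && (B < b)%N) weight R h b <= e.
Proof.
move=> h0 e0; pose s N : R := \sum_(b <- index_iota 1 N.+1 | power_free h b) weight R h b.
pose S := [set s N | N in setT].
have hS : has_sup S.
  split; first by exists (s 0%N), 0%N.
  by exists (expR (h%:R * (h%:R + 1))) => _ [N _ <-]; exact: sum_weight_le.
have [_ [B _ <-] sB] := sup_adherent e0 hS.
exists B => N; have [NB|BN] := leqP N B.
  rewrite big_seq_cond big1 ?(ltW e0)// => b /andP[].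
  by rewrite mem_index_iota => /andP[_ bN] /andP[_ Bb]; lia.
have : s N <= sup S by apply: (ub_le_sup hS.2); exists N.
have -> : s N = s B + \sum_(b <- index_iota 1 N.+1 | power_free h b && (B < b)%N) weight R h b.
  have E : index_iota 1 N.+1 = index_iota 1 B.+1 ++ index_iota B.+1 N.+1.
    by rewrite /index_iota !subSS !subn0 -{1}(subnKC (ltnW BN)) iotaD add1n.
  have Z : \sum_(b <- index_iota 1 B.+1 | power_free h b && (B < b)%N) weight R h b = 0.
    rewrite big_seq_cond big1// => b /andP[].
    by rewrite mem_index_iota => /andP[_ bB] /andP[_ Bb]; lia.
  rewrite /s E !big_cat /= Z add0r.
  congr (_ + _); rewrite big_seq_cond [RHS]big_seq_cond; apply: eq_bigl => b.
  rewrite mem_index_iota; case: (leqP B.+1 b) => //=; rewrite ?andbT//.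
lra.
Qed.

(** Uniformity over the finitely many b <= B: for each of them the range of l tends to infinity with
    N. *)
Lemma eventually_twisted (R : realType) h (a e : R) B : (0 < h)%N -> 0 < e ->
  exists N0, forall N b, (N0 <= N)%N -> (0 < b <= B)%N ->
  `|avg (root_floor h (twist h b) N) (fun l => (ek_cond h a (l ^ h * twist h b))%:R) - Phi a| <= e.
Proof.
move=> h0 e0; elim: B => [|B [N0 IH]]; first by exists 0%N => N b _; lia.
have c := @twisted_cdf_cvg R h B.+1 a h0 (ltn0Sn B).
have [M _ HM] := (cvgrPdist_le _ _).1 c _ e0.
exists (maxn N0 (M ^ h * twist h B.+1)) => N b; rewrite geq_max => /andP[N0N MN].
move=> /andP[b0]; rewrite leq_eqVlt => /predU1P[->|bB].
  by rewrite distrC; apply: HM; rewrite /= -root_floorP// twist_gt0.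
by apply: IH => //; rewrite b0.
Qed.

Lemma avg_boundE (R : realType) Y (f : nat -> bool) :
  (\sum_(1 <= l < Y.+1) f l)%N%:R = Y%:R * avg Y (fun l => (f l)%:R) :> R.
Proof.
rewrite natr_sum /avg; case: Y => [|Y]; first by rewrite big_geq// mul0r.
by rewrite mulrC divfK// pnatr_eq0.
Qed.

Lemma h_full_count_approx (R : realType) h (a e : R) : (0 < h)%N -> 0 < e ->
  exists N0, forall N, (N0 <= N)%N ->
  let S := (count (fun n => `[< h_full h n >] && predT n) (index_iota 1 N.+1))%:R in
  let A := (count (fun n => `[< h_full h n >] && ek_cond h a n) (index_iota 1 N.+1))%:R in
  0 < S /\ `|A - Phi a * S| <= e * S.
Proof.
(* The 2 comes from [root_floor_weight], and 1 + |Phi a| bounds any deviation trivially. The terms b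
   > B thus total at most K Y1 times the tail e / (2K), that is e Y1 / 2 <= e S / 2, as Y1 is the
   term b = 1 of S. *)
move=> h0 e0; pose K : R := 2 * (1 + `|Phi a|).
have K0 : 0 < K by rewrite mulr_gt0// ltr_wpDr.
have e20 : 0 < e / 2 by rewrite divr_gt0.
have [B HB] := weight_tail h0 (divr_gt0 e20 K0).
have [N0 HN] := eventually_twisted a B h0 e20.
exists (maxn N0 1) => N; rewrite geq_max => /andP[N0N N1].
rewrite !count_h_full//=.
pose Y b := root_floor h (twist h b) N.
have -> : (\sum_(b <- index_iota 1 N.+1 | power_free h b) \sum_(1 <= l < (Y b).+1) true)%N%:R =
    \sum_(b <- index_iota 1 N.+1 | power_free h b) (Y b)%:R :> R.
  rewrite natr_sum; apply: eq_bigr => b _.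
  by rewrite sum_nat_const_nat muln1 subn1.
rewrite [in X in _ /\ X]natr_sum.
under eq_bigr => b _ do rewrite avg_boundE.
rewrite -/(Y _).
set S := \sum_(b <- _ | _) (Y b)%:R.
have Y10 : (0 < Y 1)%N by rewrite /Y -root_floorP ?twist_gt0// twist1 exp1n.
have Y1S : (Y 1%N)%:R <= S.
  rewrite /S (big_rem 1%N) /=; last by rewrite mem_index_iota.
  by rewrite /power_free /= lerDl sumr_ge0.
have S0 : 0 < S by rewrite (lt_le_trans _ Y1S)// ltr0n.
split => //; rewrite /S mulr_sumr -sumrB (le_trans (ler_norm_sum _ _ _))// -/S.
apply: (@le_trans _ _ (\sum_(b <- index_iota 1 N.+1 | power_free h b)
   (e / 2 * (Y b)%:R + K * (Y 1%N)%:R * (if (B < b)%N then weight R h b else 0)))).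
  rewrite big_seq_cond [leRHS]big_seq_cond; apply: ler_sum => b /andP[].
  rewrite mem_index_iota => /andP[b0 bN] pf.
  rewrite (mulrC (Phi a)) -mulrBr normrM normr_nat.
  have [bB|Bb] := leqP b B.
    by rewrite mulr0 addr0 mulrC ler_wpM2r// HN// b0.
  have t0 : 0 <= e / 2 * (Y b)%:R by rewrite mulr_ge0// ltW.
  rewrite -[leLHS]add0r lerD// -/(Y b).
  apply: (@le_trans _ _ ((Y b)%:R * (1 + `|Phi a|))).
    rewrite ler_wpM2l// (le_trans (ler_normB _ _))// lerD2r.
    rewrite (le_trans (ler_norm_avg _ _))//.
    have [Yb0|Yb0] := posnP (Y b); first by rewrite Yb0 /avg big_geq// mul0r.
    rewrite -[leRHS](avg_cst 1 Yb0); apply: le_avg => l _.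
    by rewrite normr_nat lern1; case: (ek_cond _ _ _).
  have := root_floor_weight R b h0 N1; rewrite -/(Y b) -/(Y 1%N) => H.
  have := ler_wpM2r (_ : 0 <= 1 + `|Phi a|) H; rewrite addr_ge0// => /(_ isT).
  by rewrite /K; lra.
rewrite big_split /= -!mulr_sumr -/S.
have W := HB N; rewrite big_mkcondr in W.
have := ler_wpM2l (_ : 0 <= K * (Y 1%N)%:R) W; rewrite mulr_ge0 ?(ltW K0)// => /(_ isT).
rewrite (_ : K * _ * (e / 2 / K) = (Y 1%N)%:R * (e / 2)); last by field; rewrite gt_eqF.
have := ler_wpM2r (ltW e20) Y1S; lra.
Qed.

Theorem theorem1p6 (R : realType) (h : nat) (hh : (2 <= h)%N) (a : R) :
  (fun x : R =>
     #|` fset_set [set n : nat | [/\ Nfull h x n, (3 <= n)%N &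
         ((omegah h n)%:R - ln (ln n%:R)) / Num.sqrt (ln (ln n%:R)) <= a]]|%:R
     / #|` fset_set (Nfull h x)|%:R : R) @ +oo%R --> Phi a.
Proof.
have h0 : (0 < h)%N by exact: ltnW.
apply/cvgrPdist_le => e e0; have [N0 HN] := h_full_count_approx a h0 e0.
near=> x; have x0 : 0 <= x by near: x; exact: nbhs_pinfty_ge.
pose N := Num.truncn x.
have N0N : (N0 <= N)%N by rewrite truncn_ge_nat//; near: x; exact: nbhs_pinfty_ge.
have nN n : (n%:R <= x) = (n <= N)%N by rewrite /N truncn_ge_nat.
rewrite (@card_fset_set_nat _ N); last first.
  by move=> n [[[n0 _] nx] _ _]; rewrite n0 -nN.
rewrite (@card_fset_set_nat (Nfull h x) N); last first.
  by move=> n [[n0 _] nx]; rewrite n0 -nN.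
have [S0 H] := HN N N0N.
set A := count _ _; set S := count _ _.
have -> : S = count (fun n => `[< h_full h n >] && predT n) (index_iota 1 N.+1).
  apply: eq_in_count => n; rewrite mem_index_iota ltnS => /andP[_ nx].
  by rewrite andbT; apply: asbool_equiv_eq; split => [[]//|]; split => //; rewrite nN.
have -> : A = count (fun n => `[< h_full h n >] && ek_cond h a n) (index_iota 1 N.+1).
  apply: eq_in_count => n; rewrite mem_index_iota ltnS => /andP[_ nx].
  apply/asboolP/idP => [[[nf _] n3 na]|/andP[/asboolP nf /andP[n3 na]]].
    by rewrite /ek_cond n3 /= na andbT; exact/asboolP.
  by split => //; split => //; rewrite nN.
rewrite distrC -(ler_pM2r S0) (le_trans _ H)// -[X in _ * X](gtr0_norm S0) -normrM.
by rewrite mulrBl divfK ?gt_eqF.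
Unshelve. all: end_near. Qed.
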